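(* Let $(X,f,R)$ be a virtual biquandle with $R=(R_1,R_2)$, and let $VR\colon X\times X\to X\times X$ be given by $VR(x,y)=\big(R_1(x,f(y)),\,R_2(f^{-1}(x),y)\big)$ (so that $(X,VR)$ is a biquandle). Let $L$ be an oriented virtual link diagram. Then the set of colorings of $L$ by $(X,f,R)$ under the virtual biquandle coloring rule is in bijection with the set of colorings of $L$ by $(X,VR)$ under the biquandle coloring rule.
   Context: A biquandle is a non-empty set $X$ with a map $R\colon X\times X\to X\times X$, $R(x,y)=(R_1(x,y),R_2(x,y))$, such that: (1) $(R\times \mathrm{id})(\mathrm{id}\times R)(R\times \mathrm{id})=(\mathrm{id}\times R)(R\times \mathrm{id})(\mathrm{id}\times R)$ on $X^3$; (2) $R$ is invertible; (3) for any $x,z\in X$ there is a unique $y\in X$ with $R_1(x,y)=z$; (4) for any $y,w\in X$ there is a unique $x\in X$ with $R_2(x,y)=w$; (5) for any $a\in X$ there is a unique $x\in X$ with $R(x,a)=(x,a)$. A virtual biquandle is a triple $(X,f,R)$ where $(X,R)$ is a biquandle and $f\colon X\to X$ is an automorphism of it, i.e. a bijection with $(f\times f)\circ R=R\circ (f\times f)$. Write $R^{-1}=(\overline{R_1},\overline{R_2})$. It is known that $(X,VR)$ is a biquandle. A virtual link diagram is a generic immersion of finitely many circles in the plane $\mathbb{R}^2$ or the sphere $\mathbb{S}^2$ whose double points are each decorated either as a classical crossing (with over/under information) or as a virtual crossing (no such information). It is oriented if each circle is oriented. A semiarc is an arc of the diagram between two consecutive double points (classical or virtual); a component without double points is a single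 semiarc. At each crossing, rotate the picture in the plane so that both strands point downward; call the incoming semiarcs top-left and top-right, and the outgoing ones bottom-left and bottom-right. A classical crossing is positive if the over-strand runs from top-right to bottom-left, and negative if the over-strand runs from top-left to bottom-right. Virtual biquandle coloring rule: a coloring of $L$ by $(X,f,R)$ is an assignment of elements of $X$ to the semiarcs of $L$ such that at each crossing, if the top-left label is $x$ and the top-right label is $y$, then the (bottom-left, bottom-right) labels are: $(R_1(x,y),R_2(x,y))$ at a positive crossing; $(\overline{R_1}(x,y),\overline{R_2}(x,y))$ at a negative crossing; $(f^{-1}(y),f(x))$ at a virtual crossing. (Equivalently, a coloring is a virtual biquandle homomorphism to $(X,f,R)$ from the virtual biquandle generated by the semiarcs subject to these relations.) Biquandle coloring rule: a coloring of $L$ by a biquandle $(X,S)$, with $S=(S_1,S_2)$ and $S^{-1}=(\overline{S_1},\overline{S_2})$, is an assignment of elements of $X$ to the semiarcs such that, with the same notation, the (bottom-left, bottom-right) labels are: $(S_1(x,y),S_2(x,y))$ at a positive crossing; $(\overline{S_1}(x,y),\overline{S_2}(x,y))$ at a negative crossing; $(y,x)$ at a virtual crossing. Here it is used with $S=VR$. *)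

(* Defs.v *)
From Stdlib Require Import Reals ZArith.
From Stdlib Require Fin FinFun.
From Coquelicot Require Import Coquelicot.

Open Scope R_scope.

(** * Biquandles and virtual biquandles *)

Definition left_pair {X : Type} (R : X * X -> X * X) (t : X * X * X) :
    X * X * X :=
  let '(x, y, z) := t in (fst (R (x, y)), snd (R (x, y)), z).

Definition right_pair {X : Type} (R : X * X -> X * X) (t : X * X * X) :
    X * X * X :=
  let '(x, y, z) := t in (x, fst (R (y, z)), snd (R (y, z))).

(** The inverse of [bq_op] is carried along because the rule at a negative
    crossing uses it; it is determined by [bq_op]. *)
Record biquandle (X : Type) := Biquandle {
  bq_op : X * X -> X * X;
  bq_inv : X * X -> X * X;
  bq_nonempty : inhabited X;
  bq_yang_baxter : forall t : X * X * X,
    left_pair bq_op (right_pair bq_op (left_pair bq_op t)) =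
    right_pair bq_op (left_pair bq_op (right_pair bq_op t));
  bq_opK : forall p, bq_inv (bq_op p) = p;
  bq_invK : forall p, bq_op (bq_inv p) = p;
  bq_left_solve : forall x z, exists! y, fst (bq_op (x, y)) = z;
  bq_right_solve : forall y w, exists! x, snd (bq_op (x, y)) = w;
  bq_fixed : forall a, exists! x, bq_op (x, a) = (x, a)
}.

Arguments bq_op {X}.
Arguments bq_inv {X}.

Definition map_pair {X : Type} (f : X -> X) (p : X * X) : X * X :=
  (f (fst p), f (snd p)).

Record virtual_biquandle (X : Type) := VirtualBiquandle {
  vb_bq : biquandle X;
  vb_f : X -> X;
  vb_finv : X -> X;
  vb_fK : forall x, vb_finv (vb_f x) = x;
  vb_finvK : forall x, vb_f (vb_finv x) = x;
  vb_f_op : forall p, map_pair vb_f (bq_op vb_bq p) = bq_op vb_bq (map_pair vb_f p)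
}.

Arguments vb_bq {X}.
Arguments vb_f {X}.
Arguments vb_finv {X}.

Definition VR {X : Type} (V : virtual_biquandle X) (p : X * X) : X * X :=
  (fst (bq_op (vb_bq V) (fst p, vb_f V (snd p))),
   snd (bq_op (vb_bq V) (vb_finv V (fst p), snd p))).

(** ** [(X, VR)] is a biquandle *)

Section VRBiquandle.

Context {X : Type} (V : virtual_biquandle X).

Local Notation R := (bq_op (vb_bq V)).
Local Notation R' := (bq_inv (vb_bq V)).
Local Notation f := (vb_f V).
Local Notation g := (vb_finv V).

Let fK : forall x, g (f x) = x := vb_fK X V.
Let gK : forall x, f (g x) = x := vb_finvK X V.

Lemma op_f x y : R (f x, f y) = (f (fst (R (x, y))), f (snd (R (x, y)))).
Proof. exact (eq_sym (vb_f_op X V (x, y))). Qed.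

(** [VR] is the conjugate of [R] by [id * f]. *)
Lemma VR_conj x y : VR V (x, y) = (fst (R (x, f y)), g (snd (R (x, f y)))).
Proof.
unfold VR; simpl; f_equal.
rewrite <- (gK x) at 2; rewrite op_f; simpl; now rewrite fK.
Qed.

Definition VR_inv (p : X * X) : X * X :=
  (fst (R' (fst p, f (snd p))), g (snd (R' (fst p, f (snd p))))).

Lemma VR_invK p : VR V (VR_inv p) = p.
Proof.
destruct p as [x y]; unfold VR_inv; rewrite VR_conj; simpl.
rewrite gK, <- surjective_pairing, (bq_invK X); simpl; now rewrite fK.
Qed.

Lemma VRK p : VR_inv (VR V p) = p.
Proof.
destruct p as [x y]; rewrite VR_conj; unfold VR_inv; simpl.
rewrite gK, <- surjective_pairing, (bq_opK X); simpl; now rewrite fK.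
Qed.

Let F (t : X * X * X) : X * X * X := let '(x, y, z) := t in (x, f y, f (f z)).
Let G (t : X * X * X) : X * X * X := let '(x, y, z) := t in (x, g y, g (g z)).

Lemma VR_yang_baxter t :
  left_pair (VR V) (right_pair (VR V) (left_pair (VR V) t)) =
  right_pair (VR V) (left_pair (VR V) (right_pair (VR V) t)).
Proof.
assert (GF : forall s, G (F s) = s)
  by (intros [[a b] c]; simpl; now rewrite !fK).
assert (HL : forall s, F (left_pair (VR V) s) = left_pair R (F s)).
{ intros [[a b] c]; unfold left_pair; rewrite VR_conj; simpl.
  now rewrite gK. }
assert (HR : forall s, F (right_pair (VR V) s) = right_pair R (F s)).
{ intros [[a b] c]; unfold right_pair; rewrite VR_conj; simpl.
  now rewrite gK, op_f. }
assert (Finj : forall s s', F s = F s' -> s = s')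
  by (intros s s' E; now rewrite <- (GF s), E, GF).
apply Finj.
repeat (rewrite HL || rewrite HR).
now rewrite (bq_yang_baxter X).
Qed.

Lemma VR_left_solve x z : exists! y, fst (VR V (x, y)) = z.
Proof.
destruct (bq_left_solve X (vb_bq V) x z) as [y [Hy Uy]].
exists (g y); split.
- now rewrite VR_conj, gK.
- intros y'; rewrite VR_conj; simpl; intros H.
  now rewrite (Uy _ H), fK.
Qed.

Lemma VR_right_solve y w : exists! x, snd (VR V (x, y)) = w.
Proof.
destruct (bq_right_solve X (vb_bq V) y w) as [x [Hx Ux]].
exists (f x); split.
- unfold VR; simpl; now rewrite fK.
- intros x'; unfold VR; simpl; intros H.
  now rewrite (Ux _ H), gK.
Qed.

Lemma VR_fixed a : exists! x, VR V (x, a) = (x, a).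
Proof.
destruct (bq_fixed X (vb_bq V) (f a)) as [x [Hx Ux]].
exists x; split.
- rewrite VR_conj, Hx; simpl; now rewrite fK.
- intros x'; rewrite VR_conj; intros H; apply Ux.
  injection H; intros H2 H1.
  rewrite (surjective_pairing (R _)), H1; f_equal.
  now rewrite <- (gK (snd _)), H2.
Qed.

Definition VR_biquandle : biquandle X :=
  Biquandle X (VR V) VR_inv (bq_nonempty X (vb_bq V))
    VR_yang_baxter VRK VR_invK VR_left_solve VR_right_solve VR_fixed.

End VRBiquandle.

(** * Oriented virtual link diagrams *)

(** Both surfaces sit in [R^3], the plane as [z = 0]; they are oriented by the
    normal [(0, 0, 1)], respectively the outward normal. *)
Inductive surface := Plane | Sphere.

Definition R3 : Type := (R * R * R)%type.

Definition on_surface (S : surface) (p : R3) : Prop :=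
  let '(x, y, z) := p in
  match S with
  | Plane => z = 0
  | Sphere => x ^ 2 + y ^ 2 + z ^ 2 = 1
  end.

Definition normal (S : surface) (p : R3) : R3 :=
  match S with
  | Plane => (0, 0, 1)
  | Sphere => p
  end.

Definition det3 (u v w : R3) : R :=
  let '(u1, u2, u3) := u in
  let '(v1, v2, v3) := v in
  let '(w1, w2, w3) := w in
  u1 * (v2 * w3 - v3 * w2) - u2 * (v1 * w3 - v3 * w1)
    + u3 * (v1 * w2 - v2 * w1).

(** What the decoration of a double point says about one of its two strands. *)
Inductive strand := Over | Under | Virtual.

Definition dual_strand (s : strand) : strand :=
  match s with
  | Over => Under
  | Under => Over
  | Virtual => Virtual
  end.

(** The circles are copies of [R / Z]: the pair [(i, t)] stands for the class
    of [t] on the [i]-th circle. *)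
Definition same_point {n : nat} (P Q : Fin.t n * R) : Prop :=
  fst P = fst Q /\ exists k : Z, snd P = snd Q + IZR k.

Definition meet {n : nat} (c : Fin.t n -> R -> R3) (P Q : Fin.t n * R) : Prop :=
  c (fst P) (snd P) = c (fst Q) (snd Q) /\ ~ same_point P Q.

(** Circles are oriented by increasing parameter. As the circles are compact and
    double points are transverse, there are finitely many double points.
    Values of [dg_strand] away from double points are irrelevant. *)
Record diagram := Diagram {
  dg_surface : surface;
  dg_n : nat;
  dg_curve : Fin.t dg_n -> R -> R3;
  dg_velocity : Fin.t dg_n -> R -> R3;
  dg_strand : Fin.t dg_n * R -> strand;
  dg_on_surface : forall i t, on_surface dg_surface (dg_curve i t);
  dg_periodic : forall i t, dg_curve i (t + 1) = dg_curve i t;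
  dg_derive : forall i (t : R), is_derive (dg_curve i) t (dg_velocity i t);
  dg_C1 : forall i (t : R), continuous (dg_velocity i) t;
  dg_immersion : forall i t, dg_velocity i t <> (0, 0, 0);
  dg_transverse : forall P Q, meet dg_curve P Q ->
    det3 (normal dg_surface (dg_curve (fst P) (snd P)))
      (dg_velocity (fst P) (snd P)) (dg_velocity (fst Q) (snd Q)) <> 0;
  dg_no_triple : forall P Q Q',
    meet dg_curve P Q -> meet dg_curve P Q' -> same_point Q Q';
  dg_strand_same : forall P Q, same_point P Q -> dg_strand P = dg_strand Q;
  dg_strand_meet : forall P Q, meet dg_curve P Q ->
    dg_strand Q = dual_strand (dg_strand P)
}.

Definition circle_point (L : diagram) : Type := (Fin.t (dg_n L) * R)%type.

Definition ordinary (L : diagram) (P : circle_point L) : Prop :=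
  ~ exists Q, meet (dg_curve L) P Q.

Definition same_semiarc (L : diagram) (P Q : circle_point L) : Prop :=
  fst P = fst Q /\
  exists k : Z, forall r,
    Rmin (snd P) (snd Q + IZR k) <= r <= Rmax (snd P) (snd Q + IZR k) ->
    ordinary L (fst P, r).

(** Semiarcs are the classes of ordinary points under [same_semiarc], that is,
    the connected components of the circles with the preimages of the double
    points removed. *)
Definition semiarc (L : diagram) : Type :=
  { A : circle_point L -> Prop |
    exists P, ordinary L P /\ forall Q, A Q <-> same_semiarc L P Q }.

Definition incoming (L : diagram) (P : circle_point L) (A : semiarc L) : Prop :=
  exists e, 0 < e /\
    forall r, snd P - e < r < snd P -> proj1_sig A (fst P, r).

Definition outgoing (L : diagram) (P : circle_point L) (A : semiarc L) : Prop :=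
  exists e, 0 < e /\
    forall r, snd P < r < snd P + e -> proj1_sig A (fst P, r).

(** The strands through [P] and [Q] cross, and with both pointing downward the
    one through [P] runs from top-left to bottom-right and the one through [Q]
    from top-right to bottom-left: model directions are [(1, -1)] for [P] and
    [(-1, -1)] for [Q], a negative frame. *)
Definition crossing (L : diagram) (P Q : circle_point L) : Prop :=
  meet (dg_curve L) P Q /\
  det3 (normal (dg_surface L) (dg_curve L (fst P) (snd P)))
    (dg_velocity L (fst P) (snd P)) (dg_velocity L (fst Q) (snd Q)) < 0.

Inductive crossing_kind := PositiveCrossing | NegativeCrossing | VirtualCrossing.

(** Here [P] is on the strand from top-left to bottom-right. *)
Definition kind (L : diagram) (P : circle_point L) : crossing_kind :=
  match dg_strand L P with
  | Over => NegativeCrossing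
  | Under => PositiveCrossing
  | Virtual => VirtualCrossing
  end.

(** * Colorings *)

(** A rule maps the (top-left, top-right) labels to the
    (bottom-left, bottom-right) ones. *)
Definition obeys {X : Type} (L : diagram)
    (rule : crossing_kind -> X * X -> X * X) (c : semiarc L -> X) : Prop :=
  forall (P Q : circle_point L) (TL TR BL BR : semiarc L),
    crossing L P Q ->
    incoming L P TL -> incoming L Q TR ->
    outgoing L Q BL -> outgoing L P BR ->
    (c BL, c BR) = rule (kind L P) (c TL, c TR).

Definition virtual_biquandle_rule {X : Type} (V : virtual_biquandle X)
    (k : crossing_kind) (p : X * X) : X * X :=
  match k with
  | PositiveCrossing => bq_op (vb_bq V) p
  | NegativeCrossing => bq_inv (vb_bq V) p
  | VirtualCrossing => (vb_finv V (snd p), vb_f V (fst p))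
  end.

Definition biquandle_rule {X : Type} (B : biquandle X)
    (k : crossing_kind) (p : X * X) : X * X :=
  match k with
  | PositiveCrossing => bq_op B p
  | NegativeCrossing => bq_inv B p
  | VirtualCrossing => (snd p, fst p)
  end.

Definition virtual_biquandle_coloring {X : Type} (V : virtual_biquandle X)
    (L : diagram) : Type :=
  { c : semiarc L -> X | obeys L (virtual_biquandle_rule V) c }.

Definition biquandle_coloring {X : Type} (B : biquandle X)
    (L : diagram) : Type :=
  { c : semiarc L -> X | obeys L (biquandle_rule B) c }.

(* Main.v *)
Require Import Defs.
From Stdlib Require Import FinFun Reals ZArith Lra Lia Psatz List.
From Stdlib Require Import Classical ClassicalEpsilon FunctionalExtensionality.
From Coquelicot Require Import Coquelicot.

(** If the semiarcs carry integers [a] that are, at every crossing, [k] on the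
    top-left and bottom-left and [k + 1] on the top-right and bottom-right, then
    twisting the label of each semiarc [A] by the power [a A] of the automorphism
    exchanges the two kinds of colorings, whatever the kind of the crossing.

    Such an Alexander numbering is the restriction to the curves of an integer
    function on the surface which is constant off the curves and is one higher on
    the left of a strand than on the strand and on its right. Near a given point
    of the surface such a function exists: the number of strands through the point
    that have the argument strictly on their left. These local functions agree
    locally up to integer constants, so they form a cocycle with values in the
    constant sheaf [Z], and the cocycle is trivial because the surface is simply
    connected: local solutions are glued along connected intersections, first over
    rectangles in the plane or in a hemisphere, and then the two hemispheres along
    the equator. *)

(** The exponents k and k + 1 come from [VR] being the conjugate of [R] by the map sending (x, y) to
    (x, f y). They belong to the left and right positions at a crossing, not to the strands, so both
    strands change their exponent there, one up and one down. The obstacle is geometric: the strands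
    are only C^1 and no straightening coordinates at a point are available. The sides of a strand
    are therefore unions of cones with apex on the curve and axis along a fixed normal. If the cones
    are neither too wide nor too narrow, the two sides are open, disjoint, avoid the strand, cover
    the nearby points of the surface off the strand, and contain the two halves of a strand crossing
    it. Each constant below serves one of these requirements. Semiarcs lie on the curves, so the
    integer function has to be defined there as well. Counting a point of the strand itself as 0
    makes a strand contribute nothing along itself; only the other strand of a double point changes
    the value. *)

(** * Euclidean geometry of space *)

Definition vsub (p q : R3) : R3 :=
  let '(a, b, c) := p in let '(a', b', c') := q in (a - a', b - b', c - c').

Definition dot (p q : R3) : R :=
  let '(a, b, c) := p in let '(a', b', c') := q in a * a' + b * b' + c * c'.

Definition cross (p q : R3) : R3 :=
  let '(a, b, c) := p in let '(a', b', c') := q in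
  (b * c' - c * b', c * a' - a * c', a * b' - b * a').

Definition nrm (p : R3) : R := sqrt (dot p p).

Definition edist (p q : R3) : R := nrm (vsub p q).

Lemma dot_ge0 p : 0 <= dot p p.
Proof. destruct p as [[a b] c]; simpl; nra. Qed.

Lemma nrm_ge0 p : 0 <= nrm p.
Proof. apply sqrt_pos. Qed.

Lemma nrm_sqr p : nrm p * nrm p = dot p p.
Proof. apply sqrt_sqrt, dot_ge0. Qed.

Lemma edist_ge0 p q : 0 <= edist p q.
Proof. apply nrm_ge0. Qed.

Lemma det3_dot u v w : det3 u v w = dot (cross u v) w.
Proof.
destruct u as [[u1 u2] u3], v as [[v1 v2] v3], w as [[w1 w2] w3]; simpl; ring.
Qed.

Lemma cauchy_schwarz p q : Rabs (dot p q) <= nrm p * nrm q.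
Proof.
rewrite <- (Rabs_pos_eq (nrm p * nrm q))
  by (apply Rmult_le_pos; apply nrm_ge0).
apply Rsqr_le_abs_0; unfold Rsqr.
replace (nrm p * nrm q * (nrm p * nrm q))
  with (nrm p * nrm p * (nrm q * nrm q)) by ring.
rewrite !nrm_sqr.
destruct p as [[a b] c], q as [[a' b'] c']; simpl.
(* Lagrange's identity: the defect in the inequality is the sum of the squares of the coordinates of
   the cross product. *)
pose proof (Rle_0_sqr (a * b' - b * a')).
pose proof (Rle_0_sqr (b * c' - c * b')).
pose proof (Rle_0_sqr (c * a' - a * c')).
unfold Rsqr in *; nra.
Qed.

Lemma dot_vsub_r n p q : dot n (vsub p q) = dot n p - dot n q.
Proof. destruct n as [[? ?] ?], p as [[? ?] ?], q as [[? ?] ?]; simpl; ring. Qed.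

Lemma dot_vsub_l n p q : dot (vsub p q) n = dot p n - dot q n.
Proof. destruct n as [[? ?] ?], p as [[? ?] ?], q as [[? ?] ?]; simpl; ring. Qed.

Lemma edist_sym p q : edist p q = edist q p.
Proof.
unfold edist, nrm; f_equal; destruct p as [[? ?] ?], q as [[? ?] ?]; simpl; ring.
Qed.

Lemma edist_refl p : edist p p = 0.
Proof.
unfold edist, nrm; rewrite <- sqrt_0; f_equal; destruct p as [[? ?] ?]; simpl; ring.
Qed.

Lemma nrm_eq0 p : nrm p = 0 -> p = (0, 0, 0).
Proof.
intros E; pose proof (nrm_sqr p) as H; rewrite E in H.
destruct p as [[a b] c]; simpl in H.
assert (a = 0) by nra; assert (b = 0) by nra; assert (c = 0) by nra.
now subst.
Qed.

Lemma edist_eq0 p q : edist p q = 0 -> p = q.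
Proof.
intros E; apply nrm_eq0 in E.
destruct p as [[? ?] ?], q as [[? ?] ?]; simpl in E.
injection E; intros; repeat f_equal; lra.
Qed.

Lemma edist_pos p q : p <> q -> 0 < edist p q.
Proof.
intros H; destruct (edist_ge0 p q) as [? | E]; trivial.
now destruct H; apply edist_eq0.
Qed.

Lemma edist_triangle p q r : edist p r <= edist p q + edist q r.
Proof.
pose proof (edist_ge0 p q) as Hp; pose proof (edist_ge0 q r) as Hq.
apply Rsqr_incr_0_var; [|lra]; unfold Rsqr.
pose proof (cauchy_schwarz (vsub p q) (vsub q r)) as C.
apply Rabs_le_between in C.
assert (E : edist p r * edist p r = edist p q * edist p q + edist q r * edist q r
              + 2 * dot (vsub p q) (vsub q r)).
{ unfold edist; rewrite !nrm_sqr.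
  destruct p as [[? ?] ?], q as [[? ?] ?], r as [[? ?] ?]; simpl; ring. }
rewrite E; unfold edist in *; nra.
Qed.

Lemma nrm_edist p q : nrm p <= nrm q + edist p q.
Proof.
pose proof (edist_triangle p q (0, 0, 0)) as H.
unfold edist at 1 3 in H.
replace (vsub p (0, 0, 0)) with p in H
  by (destruct p as [[? ?] ?]; simpl; now rewrite !Rminus_0_r).
replace (vsub q (0, 0, 0)) with q in H
  by (destruct q as [[? ?] ?]; simpl; now rewrite !Rminus_0_r).
lra.
Qed.

Lemma nrm_le_sum a b c : nrm (a, b, c) <= Rabs a + Rabs b + Rabs c.
Proof.
pose proof (Rabs_pos a); pose proof (Rabs_pos b); pose proof (Rabs_pos c).
apply Rsqr_incr_0_var; [|lra]; unfold Rsqr; rewrite nrm_sqr; simpl.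
assert (S : forall x, x * x = Rabs x * Rabs x).
{ intros x; unfold Rabs; destruct (Rcase_abs x); ring. }
rewrite (S a), (S b), (S c); nra.
Qed.

Lemma coord_le_nrm a b c :
  Rabs a <= nrm (a, b, c) /\ Rabs b <= nrm (a, b, c) /\ Rabs c <= nrm (a, b, c).
Proof.
pose proof (nrm_ge0 (a, b, c)) as H; pose proof (nrm_sqr (a, b, c)) as E; simpl in E.
repeat split; apply Rabs_le; split; nra.
Qed.

Lemma lt_Rmin a x y : a < Rmin x y -> a < x /\ a < y.
Proof. pose proof (Rmin_l x y); pose proof (Rmin_r x y); lra. Qed.

(** Cousin's lemma. *)
Lemma interval_induction (Q : R -> R -> Prop) a b :
  a <= b ->
  (forall x y z, x <= y <= z -> Q x y -> Q y z -> Q x z) ->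
  (forall x, a <= x <= b ->
     exists d, 0 < d /\
       forall u v, a <= u <= x -> x <= v <= b -> v - u < d -> Q u v) ->
  Q a b.
Proof.
intros ab add loc.
pose (E x := a <= x <= b /\ Q a x).
assert (Ea : E a).
{ split; [lra|].
  destruct (loc a) as [d [d0 H]]; [lra|]; apply H; lra. }
destruct (completeness E) as [m [mub mlub]].
- exists b; intros x [H _]; lra.
- now exists a.
- assert (am : a <= m) by now apply mub.
  assert (mb : m <= b) by (apply mlub; intros x [H _]; lra).
  destruct (loc m (conj am mb)) as [d [d0 H]].
  destruct (classic (exists x, E x /\ m - d / 2 < x)) as [[x [Ex mx]] | N].
  + assert (xm : x <= m) by now apply mub.
    destruct Ex as [abx Qx].
    (* [v] lies beyond the supremum [m] unless [m = b], and it is less than [d] away from [x]. So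
       [v] belongs to [E], which forces [v = b]. *)
    pose (v := Rmin b (m + d / 4)).
    assert (Hv : m <= v <= b /\ v <= m + d / 4 /\ (v = b \/ m < v)).
    { unfold v, Rmin; destruct (Rle_dec b (m + d / 4)); repeat split; lra. }
    assert (Ev : E v).
    { split; [lra|]; apply (add a x v); [lra | trivial | apply H; lra]. }
    pose proof (mub v Ev).
    assert (Evb : v = b) by lra.
    rewrite <- Evb; apply Ev.
  + exfalso.
    assert (m <= m - d / 2); [|lra].
    apply mlub; intros x Ex; apply Rnot_lt_le; intros C; apply N; now exists x.
Qed.

Lemma locally_constant_interval {A : Type} (h : R -> A) a b :
  a <= b ->
  (forall x, a <= x <= b ->
     exists d, 0 < d /\
       forall y, a <= y <= b -> Rabs (y - x) < d -> h y = h x) ->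
  h a = h b.
Proof.
intros ab loc; apply (interval_induction (fun u v => h u = h v)); trivial.
- intros x y z _ E1 E2; congruence.
- intros x abx; destruct (loc x abx) as [d [d0 H]]; exists d; split; trivial.
  intros u v ux xv uv.
  rewrite (H u), (H v); trivial; try lra; apply Rabs_lt_between; lra.
Qed.

(** * Gluing local integer functions *)

(** For coherent [ell], the functions [ell p] are local sections of a torsor under the locally
    constant integer functions, and [g] is a section over [U]. Closeness is relative to [U], which
    may be closed: pieces that share only an edge can be glued. *)
Definition trivializes (ell : R3 -> R3 -> Z) (U : R3 -> Prop) (g : R3 -> Z) :=
  forall p, U p ->
    exists (k : Z) (d : R), 0 < d /\
      forall q, U q -> edist q p < d -> g q = (ell p q + k)%Z.

Definition trivializable (ell : R3 -> R3 -> Z) (U : R3 -> Prop) :=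
  exists g, trivializes ell U g.

(** The form of connectedness that gluing needs: the difference of two trivializations is a locally
    constant integer function. *)
Definition connected (E : R3 -> Prop) :=
  forall h : R3 -> Z,
    (forall p, E p ->
       exists d, 0 < d /\ forall q, E q -> edist q p < d -> h q = h p) ->
    forall p q, E p -> E q -> h p = h q.

(** That is, [U2] is relatively closed in the union, so that near a point of [U1] alone only the
    function on [U1] matters. *)
Definition separated (U1 U2 : R3 -> Prop) :=
  forall p, U1 p -> ~ U2 p ->
    exists d, 0 < d /\ forall q, U2 q -> d <= edist q p.

Lemma trivializable_ext ell U U' :
  (forall p, U p <-> U' p) -> trivializable ell U -> trivializable ell U'.
Proof.
intros E [g Hg]; exists g; intros p Up.
destruct (Hg p) as [k [d [d0 H]]]; [now apply E|].
exists k, d; split; trivial; intros q Uq; apply H; now apply E.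
Qed.

(** On the overlap the two trivializations differ by a locally constant function, hence by one
    integer, by which the second is shifted. *)
Lemma trivializable_glue ell U1 U2 :
  separated U1 U2 -> separated U2 U1 ->
  connected (fun p => U1 p /\ U2 p) ->
  trivializable ell U1 -> trivializable ell U2 -> trivializable ell (fun p => U1 p \/ U2 p).
Proof.
intros S12 S21 C [g1 H1] [g2 H2].
assert (K : exists k, forall p, U1 p -> U2 p -> g1 p = (g2 p + k)%Z).
{ destruct (classic (exists p, U1 p /\ U2 p)) as [[p0 P0] | N].
  - exists (g1 p0 - g2 p0)%Z; intros p u1 u2.
    assert (E : (g1 p - g2 p = g1 p0 - g2 p0)%Z); [|lia].
    apply (C (fun p => (g1 p - g2 p)%Z)); auto.
    intros r [r1 r2].
    destruct (H1 r r1) as [k1 [d1 [? G1]]], (H2 r r2) as [k2 [d2 [? G2]]].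
    exists (Rmin d1 d2); split; [now apply Rmin_pos|].
    intros q [q1 q2] D.
    destruct (lt_Rmin _ _ _ D) as [D1 D2].
    rewrite (G1 q), (G2 q), (G1 r), (G2 r); trivial; rewrite ?edist_refl; trivial; lia.
  - exists 0%Z; intros p u1 u2; destruct N; eauto. }
destruct K as [k K].
pose (g q := if excluded_middle_informative (U1 q) then g1 q else (g2 q + k)%Z).
exists g.
assert (E1 : forall q, U1 q -> g q = g1 q).
{ intros q u; unfold g; now destruct (excluded_middle_informative (U1 q)). }
assert (E2 : forall q, U2 q -> g q = (g2 q + k)%Z).
{ intros q u; unfold g; destruct (excluded_middle_informative (U1 q)); auto. }
assert (L1 : forall p, U1 p -> exists (k : Z) (d : R), 0 < d /\
   forall q, U1 q -> edist q p < d -> g q = (ell p q + k)%Z).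
{ intros p u; destruct (H1 p u) as [k1 [d1 [? G1]]]; exists k1, d1; split; trivial.
  intros q uq D; rewrite E1; auto. }
assert (L2 : forall p, U2 p -> exists (k : Z) (d : R), 0 < d /\
   forall q, U2 q -> edist q p < d -> g q = (ell p q + k)%Z).
{ intros p u; destruct (H2 p u) as [k1 [d1 [? G1]]].
  exists (k1 + k)%Z, d1; split; trivial.
  intros q uq D; rewrite E2, G1; trivial; lia. }
intros p [u1 | u2].
- destruct (L1 p u1) as [k1 [d1 [? G1]]].
  destruct (classic (U2 p)) as [u2 | n2].
  + destruct (L2 p u2) as [k2 [d2 [? G2]]].
    (* Both local formulas hold at [p] itself, which identifies their constants. *)
    assert (k1 = k2) as <-.
    { pose proof (G1 p u1) as A1; pose proof (G2 p u2) as A2.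
      rewrite edist_refl in *; specialize (A1 H); specialize (A2 H0); lia. }
    exists k1, (Rmin d1 d2); split; [now apply Rmin_pos|].
    intros q [q1 | q2] D; destruct (lt_Rmin _ _ _ D);
      [apply G1 | apply G2]; trivial.
  + destruct (S12 p u1 n2) as [d2 [? F]].
    exists k1, (Rmin d1 d2); split; [now apply Rmin_pos|].
    intros q [q1 | q2] D; destruct (lt_Rmin _ _ _ D).
    * now apply G1.
    * specialize (F q q2); lra.
- destruct (L2 p u2) as [k2 [d2 [? G2]]].
  destruct (classic (U1 p)) as [u1 | n1].
  + destruct (L1 p u1) as [k1 [d1 [? G1]]].
    assert (k1 = k2) as <-.
    { pose proof (G1 p u1) as A1; pose proof (G2 p u2) as A2.
      rewrite edist_refl in *; specialize (A1 H0); specialize (A2 H); lia. }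
    exists k1, (Rmin d1 d2); split; [now apply Rmin_pos|].
    intros q [q1 | q2] D; destruct (lt_Rmin _ _ _ D);
      [apply G1 | apply G2]; trivial.
  + destruct (S21 p u2 n1) as [d1 [? F]].
    exists k2, (Rmin d1 d2); split; [now apply Rmin_pos|].
    intros q [q1 | q2] D; destruct (lt_Rmin _ _ _ D).
    * specialize (F q q1); lra.
    * now apply G2.
Qed.

(** The cocycle condition. It makes [ell p] itself a trivialization near [p]; the radius [d] may
    depend on [q]. *)
Definition coherent (ell : R3 -> R3 -> Z) (S : R3 -> Prop) :=
  forall p, S p -> exists e, 0 < e /\ forall q, S q -> edist q p < e ->
    exists (k : Z) (d : R), 0 < d /\
      forall z, S z -> edist z q < d -> ell p z = (ell q z + k)%Z.

Definition continuous3 (s : R -> R3) :=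
  forall t e, 0 < e ->
    exists d, 0 < d /\ forall u, Rabs (u - t) < d -> edist (s u) (s t) < e.

Lemma connected_path (E : R3 -> Prop) :
  (forall p q, E p -> E q -> exists s a b, a <= b /\ continuous3 s /\
     (forall t, a <= t <= b -> E (s t)) /\
     (s a = p /\ s b = q \/ s a = q /\ s b = p)) ->
  connected E.
Proof.
intros path h loc p q Ep Eq.
destruct (path p q Ep Eq) as [s [a [b [ab [cs [Es ends]]]]]].
assert (H : h (s a) = h (s b)).
{ apply (locally_constant_interval (fun t => h (s t))); trivial.
  intros t abt; destruct (loc (s t) (Es t abt)) as [e [e0 He]].
  destruct (cs t e e0) as [d [d0 Hd]].
  exists d; split; auto. }
destruct ends as [[<- <-] | [<- <-]]; auto.
Qed.

(** * Triviality over graphs of functions on plane regions *)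

(** The rectangle may exceed [D], which is the whole plane for the surface [Plane] and the unit disc
    for a hemisphere. *)
Definition patch (D : R -> R -> Prop) (h : R -> R -> R) (a b c d : R) (p : R3) :=
  let '(x, y, z) := p in a <= x <= b /\ c <= y <= d /\ D x y /\ z = h x y.

Lemma edist_le_sum x y z x' y' z' :
  edist (x, y, z) (x', y', z') <= Rabs (x - x') + Rabs (y - y') + Rabs (z - z').
Proof. apply nrm_le_sum. Qed.

Lemma coord_le_edist x y z x' y' z' :
  Rabs (x - x') <= edist (x, y, z) (x', y', z') /\
  Rabs (y - y') <= edist (x, y, z) (x', y', z') /\
  Rabs (z - z') <= edist (x, y, z) (x', y', z').
Proof. apply coord_le_nrm. Qed.

(** A Lipschitz [f] turns the gap between [f p] and the level [m] into a distance, and on the level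
    itself no point lies in one set only. *)
Lemma separated_lt (f : R3 -> R) m (U1 U2 : R3 -> Prop) :
  (forall p q, Rabs (f q - f p) <= edist q p) ->
  (forall p, U1 p -> f p <= m) -> (forall p, U2 p -> m <= f p) ->
  (forall p, U1 p -> f p = m -> U2 p) -> (forall p, U2 p -> f p = m -> U1 p) ->
  separated U1 U2 /\ separated U2 U1.
Proof.
intros lip le ge E1 E2; split; intros p up np.
- assert (f p < m).
  { destruct (Rle_lt_or_eq_dec _ _ (le p up)); trivial; now destruct np; apply E1. }
  exists (m - f p); split; [lra|]; intros q uq.
  pose proof (ge q uq); pose proof (lip p q); pose proof (Rle_abs (f q - f p)); lra.
- assert (m < f p).
  { destruct (Rle_lt_or_eq_dec _ _ (ge p up)); trivial; now destruct np; apply E2. }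
  exists (f p - m); split; [lra|]; intros q uq.
  pose proof (le q uq); pose proof (lip p q).
  pose proof (Rle_abs (-(f q - f p))); rewrite Rabs_Ropp in *; lra.
Qed.

Section Chart.

Context (S : R3 -> Prop) (ell : R3 -> R3 -> Z).
Context (D : R -> R -> Prop) (h : R -> R -> R).

Context (h_cont : forall x y, continuity_2d_pt h x y).
Context (D_closed : forall x y, ~ D x y ->
  exists e, 0 < e /\ forall u v, Rabs (u - x) < e -> Rabs (v - y) < e -> ~ D u v).
Context (D_convex_l : forall x y y' t, D x y -> D x y' -> y <= t <= y' -> D x t).
Context (D_convex_r : forall x x' y t, D x y -> D x' y -> x <= t <= x' -> D t y).
Context (D_S : forall x y, D x y -> S (x, y, h x y)).
Context (ell_coherent : coherent ell S).

Lemma chart_near x y e : 0 < e ->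
  exists d, 0 < d /\ forall u v, Rabs (u - x) < d -> Rabs (v - y) < d ->
    edist (u, v, h u v) (x, y, h x y) < e.
Proof.
intros e0; assert (e30 : 0 < e / 3) by lra.
destruct (h_cont x y (mkposreal _ e30)) as [[d d0] Hd]; simpl in Hd.
exists (Rmin d (e / 3)); split; [now apply Rmin_pos|].
intros u v Hu Hv.
pose proof (Rmin_l d (e / 3)); pose proof (Rmin_r d (e / 3)).
pose proof (edist_le_sum u v (h u v) x y (h x y)).
assert (Rabs (h u v - h x y) < e / 3) by (apply Hd; lra).
lra.
Qed.

(** The overlap lies over the line [x = m], which meets [D] in an interval by [D_convex_l]; lifting
    a segment by [h] gives the path. *)
Lemma patch_connected_l m a b c d :
  connected (fun p => patch D h a m c d p /\ patch D h m b c d p).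
Proof.
apply connected_path.
assert (H : forall y y', y <= y' -> c <= y <= d -> c <= y' <= d -> D m y -> D m y' ->
   a <= m -> m <= b -> 
   continuous3 (fun t => (m, t, h m t)) /\ forall t, y <= t <= y' ->
    patch D h a m c d (m, t, h m t) /\ patch D h m b c d (m, t, h m t)).
{ intros y y' yy' cy cy' Dy Dy' am mb; split.
  - intros t e e0; destruct (chart_near m t e e0) as [f [f0 Hf]].
    exists f; split; trivial; intros u Hu; apply Hf; trivial.
    now rewrite Rminus_diag, Rabs_R0.
  - intros t yty'; simpl; assert (D m t) by (apply (D_convex_l m y y'); auto).
    repeat split; trivial; lra. }
intros [[x y] z] [[x' y'] z'] [P1 P2] [P1' P2'];
  simpl in P1, P2, P1', P2'.
assert (x = m) by lra; assert (x' = m) by lra; subst x x'.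
destruct P1 as [? [? [? ->]]], P1' as [? [? [? ->]]].
exists (fun t => (m, t, h m t)).
destruct (Rle_or_lt y y').
- exists y, y'; destruct (H y y') as [? ?]; trivial; try lra.
  split; [lra | auto 6].
- exists y', y; destruct (H y' y) as [? ?]; trivial; try lra.
  split; [lra | auto 6].
Qed.

Lemma patch_connected_r m a b c d :
  connected (fun p => patch D h a b c m p /\ patch D h a b m d p).
Proof.
apply connected_path.
assert (H : forall x x', x <= x' -> a <= x <= b -> a <= x' <= b -> D x m -> D x' m ->
   c <= m -> m <= d -> 
   continuous3 (fun t => (t, m, h t m)) /\ forall t, x <= t <= x' ->
    patch D h a b c m (t, m, h t m) /\ patch D h a b m d (t, m, h t m)).
{ intros y y' yy' cy cy' Dy Dy' am mb; split.
  - intros t e e0; destruct (chart_near t m e e0) as [f [f0 Hf]].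
    exists f; split; trivial; intros u Hu; apply Hf; trivial.
    now rewrite Rminus_diag, Rabs_R0.
  - intros t yty'; simpl; assert (D t m) by (apply (D_convex_r y y'); auto).
    repeat split; trivial; lra. }
intros [[x y] z] [[x' y'] z'] [P1 P2] [P1' P2'];
  simpl in P1, P2, P1', P2'.
assert (y = m) by lra; assert (y' = m) by lra; subst y y'.
destruct P1 as [? [? [? ->]]], P1' as [? [? [? ->]]].
exists (fun t => (t, m, h t m)).
destruct (Rle_or_lt x x').
- exists x, x'; destruct (H x x') as [? ?]; trivial; try lra.
  split; [lra | auto 6].
- exists x', x; destruct (H x' x) as [? ?]; trivial; try lra.
  split; [lra | auto 6].
Qed.

Lemma patch_add_l m a b c d : a <= m <= b ->
  trivializable ell (patch D h a m c d) -> trivializable ell (patch D h m b c d) ->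
  trivializable ell (patch D h a b c d).
Proof.
intros amb T1 T2.
destruct (separated_lt (fun p => fst (fst p)) m (patch D h a m c d) (patch D h m b c d)) as [S1 S2].
- intros [[x y] z] [[x' y'] z']; apply coord_le_edist.
- intros [[x y] z]; simpl; lra.
- intros [[x y] z]; simpl; lra.
- intros [[x y] z]; simpl; intros; intuition lra.
- intros [[x y] z]; simpl; intros; intuition lra.
- eapply trivializable_ext; [| exact (trivializable_glue _ _ _ S1 S2 (patch_connected_l m a b c d) T1 T2)].
  intros [[x y] z]; simpl.
  destruct (Rle_or_lt x m); intuition lra.
Qed.

Lemma patch_add_r m a b c d : c <= m <= d ->
  trivializable ell (patch D h a b c m) -> trivializable ell (patch D h a b m d) ->
  trivializable ell (patch D h a b c d).
Proof.
intros amb T1 T2.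
destruct (separated_lt (fun p => snd (fst p)) m (patch D h a b c m) (patch D h a b m d)) as [S1 S2].
- intros [[x y] z] [[x' y'] z']; apply coord_le_edist.
- intros [[x y] z]; simpl; lra.
- intros [[x y] z]; simpl; lra.
- intros [[x y] z]; simpl; intros; intuition lra.
- intros [[x y] z]; simpl; intros; intuition lra.
- eapply trivializable_ext; [| exact (trivializable_glue _ _ _ S1 S2 (patch_connected_r m a b c d) T1 T2)].
  intros [[x y] z]; simpl.
  destruct (Rle_or_lt y m); intuition lra.
Qed.

(** Over a point of [D] the local function at that point trivializes every small patch; off [D],
    which is closed, small patches are empty. *)
Lemma patch_local x y : exists e, 0 < e /\
  forall a b c d, a <= x <= b -> c <= y <= d -> b - a < e -> d - c < e ->
    trivializable ell (patch D h a b c d).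
Proof.
destruct (classic (D x y)) as [Dxy | nD].
- destruct (ell_coherent _ (D_S _ _ Dxy)) as [e [e0 He]].
  destruct (chart_near x y e e0) as [f [f0 Hf]].
  exists f; split; trivial; intros a b c d axb cyd ba dc.
  exists (ell (x, y, h x y)).
  intros [[u v] w] [? [? [Duv ->]]].
  destruct (He (u, v, h u v)) as [k [g [g0 Hg]]].
  + now apply D_S.
  + apply Hf; apply Rabs_lt_between; lra.
  + exists k, g; split; trivial.
    intros [[u' v'] w'] [? [? [Duv' ->]]] Hd; apply Hg; auto.
- destruct (D_closed _ _ nD) as [e [e0 He]].
  exists e; split; trivial; intros a b c d axb cyd ba dc.
  exists (fun _ => 0%Z).
  intros [[u v] w] [? [? [Duv ->]]].
  destruct (He u v); trivial; apply Rabs_lt_between; lra.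
Qed.

(** Cousin's lemma is used twice. For fixed [x], induction along the vertical segment yields one
    width valid for the full height, as in the tube lemma; strips of such widths are then put side
    by side. *)
Lemma chart_trivial a b c d : a <= b -> c <= d -> trivializable ell (patch D h a b c d).
Proof.
intros ab cd.
apply (interval_induction (fun u v => trivializable ell (patch D h u v c d))); trivial.
{ intros x y z xyz; now apply patch_add_l. }
intros x abx.
pose (Q v w := exists e, 0 < e /\
  forall u u', u <= x <= u' -> u' - u < e -> trivializable ell (patch D h u u' v w)).
assert (H : Q c d).
{ apply interval_induction; trivial.
  - intros v w z vwz [e1 [? H1]] [e2 [? H2]].
    exists (Rmin e1 e2); split; [now apply Rmin_pos|].
    intros u u' uxu' uu'; pose proof (Rmin_l e1 e2); pose proof (Rmin_r e1 e2).
    apply (patch_add_r w); trivial; [apply H1 | apply H2]; lra.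
  - intros y cyd; destruct (patch_local x y) as [e [e0 He]].
    exists e; split; trivial; intros v w ? ? ?.
    exists e; split; trivial; intros u u' ? ?; apply He; trivial; lra. }
destruct H as [e [e0 He]]; exists e; split; trivial.
intros u v ? ? ?; apply He; lra.
Qed.

End Chart.

(** * Triviality over the plane and the sphere *)

Lemma plane_trivial ell M : 0 <= M -> coherent ell (on_surface Plane) ->
  trivializable ell (fun p => let '(x, y, z) := p in
    - M <= x <= M /\ - M <= y <= M /\ z = 0).
Proof.
intros M0 co.
eapply trivializable_ext;
  [| apply (chart_trivial (on_surface Plane) ell (fun _ _ => True) (fun _ _ => 0))
       with (a := - M) (b := M) (c := - M) (d := M)]; trivial; try lra.
- intros [[x y] z]; simpl; intuition lra.
- intros x y; apply continuity_2d_pt_const.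
- intros x y N; now destruct N.
- intros x y _; reflexivity.
Qed.

Definition disc (x y : R) := x ^ 2 + y ^ 2 <= 1.

Lemma disc_closed x y : ~ disc x y ->
  exists e, 0 < e /\ forall u v, Rabs (u - x) < e -> Rabs (v - y) < e -> ~ disc u v.
Proof.
unfold disc; intros N; apply Rnot_le_lt in N.
assert (C : continuity_2d_pt (fun u v => u * u + v * v) x y).
{ apply continuity_2d_pt_plus; apply continuity_2d_pt_mult;
    (apply continuity_2d_pt_id1 || apply continuity_2d_pt_id2). }
assert (P : 0 < x ^ 2 + y ^ 2 - 1) by lra.
destruct (C (mkposreal _ P)) as [[e e0] He]; simpl in He.
exists e; split; trivial; intros u v Hu Hv.
specialize (He u v Hu Hv); apply Rabs_lt_between in He; nra.
Qed.

Lemma disc_convex_l x y y' t : disc x y -> disc x y' -> y <= t <= y' -> disc x t.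
Proof. unfold disc; intros; assert (t * t <= y * y \/ t * t <= y' * y') by
  (destruct (Rle_or_lt 0 t); [right | left]; nra); nra. Qed.

Lemma disc_convex_r x x' y t : disc x y -> disc x' y -> x <= t <= x' -> disc t y.
Proof. unfold disc; intros; assert (t * t <= x * x \/ t * t <= x' * x') by
  (destruct (Rle_or_lt 0 t); [right | left]; nra); nra. Qed.

Lemma disc_bounds x y : disc x y -> -1 <= x <= 1 /\ -1 <= y <= 1.
Proof. unfold disc; intros; split; split; nra. Qed.

(** Continuity also holds outside the disc, because [sqrt] is 0 on negative numbers; so the chart
    can be taken over the whole square. *)
Lemma hemisphere_cont (s x y : R) :
  continuity_2d_pt (fun x y => s * sqrt (1 - x ^ 2 - y ^ 2)) x y.
Proof.
apply continuity_2d_pt_mult; [apply continuity_2d_pt_const|].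
apply (continuity_1d_2d_pt_comp sqrt).
- apply continuity_pt_filterlim, continuous_sqrt.
- apply continuity_2d_pt_minus; [apply continuity_2d_pt_minus|].
  + apply continuity_2d_pt_const.
  + apply (continuity_1d_2d_pt_comp (fun u => u ^ 2)); [| apply continuity_2d_pt_id1].
    apply derivable_continuous_pt, derivable_pt_pow.
  + apply (continuity_1d_2d_pt_comp (fun u => u ^ 2)); [| apply continuity_2d_pt_id2].
    apply derivable_continuous_pt, derivable_pt_pow.
Qed.

Lemma hemisphere_trivial ell s : s * s = 1 -> coherent ell (on_surface Sphere) ->
  trivializable ell (fun p => let '(x, y, z) := p in on_surface Sphere p /\ 0 <= s * z).
Proof.
intros ss co.
eapply trivializable_ext;
  [| apply (chart_trivial (on_surface Sphere) ell disc
             (fun x y => s * sqrt (1 - x ^ 2 - y ^ 2)))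
       with (a := - 1) (b := 1) (c := - 1) (d := 1)]; trivial; try lra.
- intros [[x y] z]; simpl.
  change (x * (x * 1) + y * (y * 1) + z * (z * 1) = 1 /\ 0 <= s * z) with
    (x ^ 2 + y ^ 2 + z ^ 2 = 1 /\ 0 <= s * z).
  split.
  + intros [_ [_ [d ->]]]; unfold disc in d.
    set (w := 1 - x * (x * 1) - y * (y * 1)).
    assert (w0 : 0 <= w) by (unfold w; nra).
    pose proof (sqrt_sqrt w w0); pose proof (sqrt_pos w).
    split; [|nra].
    replace ((s * sqrt w) ^ 2) with (s * s * (sqrt w * sqrt w)) by ring.
    rewrite ss, H; unfold w; ring.
  + intros [E z0].
    assert (d : disc x y) by (unfold disc; nra).
    destruct (disc_bounds x y d); split; [lra | split; [lra | split; [exact d|]]].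
    replace (1 - x * (x * 1) - y * (y * 1)) with ((s * z) * (s * z)).
    * rewrite sqrt_square by trivial; rewrite <- Rmult_assoc, ss; ring.
    * replace (s * z * (s * z)) with (s * s * z ^ 2) by ring; rewrite ss; lra.
- intros x y; apply hemisphere_cont.
- apply disc_closed.
- apply disc_convex_l.
- apply disc_convex_r.
- intros x y d; unfold on_surface.
  assert (w0 : 0 <= 1 - x ^ 2 - y ^ 2) by (unfold disc in d; lra).
  replace ((s * sqrt (1 - x ^ 2 - y ^ 2)) ^ 2)
    with (s * s * (sqrt (1 - x ^ 2 - y ^ 2) * sqrt (1 - x ^ 2 - y ^ 2))) by ring.
  rewrite ss, sqrt_sqrt by trivial; ring.
Qed.

(** Each half circle [s * y >= 0], with [s] equal to 1 or -1, is a graph over the first coordinate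
    and is followed to the common endpoint [(1, 0, 0)]. *)
Lemma equator_connected :
  connected (fun p => let '(x, y, z) := p in x ^ 2 + y ^ 2 = 1 /\ z = 0).
Proof.
intros g loc.
assert (H : forall s x y, s * s = 1 -> x ^ 2 + y ^ 2 = 1 -> 0 <= s * y ->
  g (x, y, 0) = g (1, 0, 0)).
{ intros s x y ss xy y0.
  pose (c t := (t, s * sqrt (1 - t ^ 2), 0) : R3).
  assert (x1 : -1 <= x <= 1) by (split; nra).
  assert (E : g (c x) = g (c 1)).
  { apply (locally_constant_interval (fun t => g (c t))); [lra|].
    intros t xt.
    assert (ct : t ^ 2 + (s * sqrt (1 - t ^ 2)) ^ 2 = 1 /\ 0 = 0).
    { split; trivial.
      replace ((s * sqrt (1 - t ^ 2)) ^ 2) with (s * s * (sqrt (1 - t ^ 2) * sqrt (1 - t ^ 2)))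
        by ring.
      rewrite ss, sqrt_sqrt by nra; ring. }
    destruct (loc (c t) ct) as [e [e0 He]].
    (* The half circle is parametrized by the restriction of the hemisphere function to second
       argument 0. *)
    assert (C : continuity_2d_pt (fun x y => s * sqrt (1 - x ^ 2 - y ^ 2)) t 0)
      by apply hemisphere_cont.
    assert (e2 : 0 < e / 2) by lra.
    destruct (C (mkposreal _ e2)) as [[d d0] Hd]; simpl in Hd.
    exists (Rmin d (e / 2)); split; [now apply Rmin_pos|].
    intros u xu ut; apply He.
    - unfold c; split; trivial.
      replace ((s * sqrt (1 - u ^ 2)) ^ 2) with (s * s * (sqrt (1 - u ^ 2) * sqrt (1 - u ^ 2)))
        by ring.
      rewrite ss, sqrt_sqrt by nra; ring.
    - unfold c; pose proof (edist_le_sum u (s * sqrt (1 - u ^ 2)) 0 t (s * sqrt (1 - t ^ 2)) 0).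
      pose proof (Rmin_l d (e / 2)); pose proof (Rmin_r d (e / 2)).
      assert (K : Rabs (s * sqrt (1 - u * (u * 1) - 0 * (0 * 1)) -
                   s * sqrt (1 - t * (t * 1) - 0 * (0 * 1))) < e / 2).
      { apply Hd; [lra|]; now rewrite Rminus_diag, Rabs_R0. }
      replace (1 - u * (u * 1) - 0 * (0 * 1)) with (1 - u ^ 2) in K by ring.
      replace (1 - t * (t * 1) - 0 * (0 * 1)) with (1 - t ^ 2) in K by ring.
      rewrite (Rminus_diag 0), Rabs_R0 in *; lra. }
  replace (x, y, 0) with (c x); [replace (1, 0, 0) with (c 1); trivial|]; unfold c;
    repeat f_equal.
  - replace (1 - 1 ^ 2) with 0 by ring; rewrite sqrt_0; ring.
  - replace (1 - x ^ 2) with ((s * y) * (s * y)).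
    + rewrite sqrt_square by trivial; rewrite <- Rmult_assoc, ss; ring.
    + replace (s * y * (s * y)) with (s * s * y ^ 2) by ring; rewrite ss; lra. }
assert (H' : forall x y, x ^ 2 + y ^ 2 = 1 -> g (x, y, 0) = g (1, 0, 0)).
{ intros x y xy; destruct (Rle_or_lt 0 y).
  - apply (H 1); lra.
  - apply (H (-1)); lra. }
intros [[x y] z] [[x' y'] z'] [E ->] [E' ->]; now rewrite (H' x y E), (H' x' y' E').
Qed.

Lemma sphere_trivial ell : coherent ell (on_surface Sphere) ->
  trivializable ell (on_surface Sphere).
Proof.
intros co.
pose proof (hemisphere_trivial ell 1 ltac:(ring) co) as T1.
pose proof (hemisphere_trivial ell (-1) ltac:(ring) co) as T2.
destruct (separated_lt (fun p => snd p) 0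
  (fun p => let '(x, y, z) := p in on_surface Sphere p /\ 0 <= -1 * z)
  (fun p => let '(x, y, z) := p in on_surface Sphere p /\ 0 <= 1 * z)) as [S1 S2].
- intros [[x y] z] [[x' y'] z']; apply coord_le_edist.
- intros [[x y] z]; simpl; lra.
- intros [[x y] z]; simpl; lra.
- intros [[x y] z]; simpl; intros; intuition lra.
- intros [[x y] z]; simpl; intros; intuition lra.
- eapply trivializable_ext; [| apply trivializable_glue; [exact S1 | exact S2 | | exact T2 | exact T1]].
  + intros [[x y] z]; destruct (Rle_or_lt 0 z); unfold on_surface; intuition lra.
  + intros g loc [[x y] z] [[x' y'] z'] [H1 H2] [H1' H2'].
    apply equator_connected.
    * intros [[u v] w] [E ->].
      destruct (loc (u, v, 0)) as [e [e0 He]]; [unfold on_surface; lra|].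
      exists e; split; trivial; intros [[u' v'] w'] [E' ->]; apply He.
      unfold on_surface; lra.
    * assert (z = 0) by lra; subst z; unfold on_surface in *; split; lra.
    * assert (z' = 0) by lra; subst z'; unfold on_surface in *; split; lra.
Qed.

(** * Differentiable curves in space *)

Lemma is_derive_fst {U V : NormedModule R_AbsRing} (f : R -> U * V) (t : R) l :
  is_derive f t l -> is_derive (fun s => fst (f s)) t (fst l).
Proof.
intros H; unfold is_derive.
apply (filterdiff_comp' f fst t _ fst H).
apply filterdiff_linear, is_linear_fst.
Qed.

Lemma is_derive_snd {U V : NormedModule R_AbsRing} (f : R -> U * V) (t : R) l :
  is_derive f t l -> is_derive (fun s => snd (f s)) t (snd l).
Proof.
intros H; unfold is_derive.
apply (filterdiff_comp' f snd t _ snd H).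
apply filterdiff_linear, is_linear_snd.
Qed.

Definition X1 (p : R3) : R := fst (fst p).
Definition X2 (p : R3) : R := snd (fst p).
Definition X3 (p : R3) : R := snd p.

Lemma is_derive_coord (f : R -> R3) (t : R) (l : R3) : is_derive f t l ->
  is_derive (fun s => X1 (f s)) t (X1 l) /\
  is_derive (fun s => X2 (f s)) t (X2 l) /\
  is_derive (fun s => X3 (f s)) t (X3 l).
Proof.
intros H; split; [|split].
- exact (is_derive_fst _ _ _ (is_derive_fst (V := R_NormedModule) f t l H)).
- exact (is_derive_snd _ _ _ (is_derive_fst (V := R_NormedModule) f t l H)).
- exact (is_derive_snd (V := R_NormedModule) f t l H).
Qed.

Lemma continuous_coord (f : R -> R3) (t : R) : continuous f t ->
  continuous (fun s => X1 (f s)) t /\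
  continuous (fun s => X2 (f s)) t /\
  continuous (fun s => X3 (f s)) t.
Proof.
intros H; split; [|split].
- apply (continuous_comp f X1); trivial; unfold X1.
  apply (continuous_comp fst fst); apply continuous_fst.
- apply (continuous_comp f X2); trivial; unfold X2.
  apply (continuous_comp fst snd); [apply continuous_fst | apply continuous_snd].
- apply (continuous_comp f X3); trivial; unfold X3; apply continuous_snd.
Qed.

Lemma coordE p : p = (X1 p, X2 p, X3 p).
Proof. now destruct p as [[a b] c]. Qed.

Lemma continuous_eps (f : R -> R) (t : R) : continuous f t ->
  forall e, 0 < e -> exists d, 0 < d /\ forall s, Rabs (s - t) < d -> Rabs (f s - f t) < e.
Proof.
intros H e e0.
assert (L : locally t (fun s => ball (f t) (mkposreal e e0) (f s)))
  by (apply (H (fun y => ball (f t) (mkposreal e e0) y)); exists (mkposreal e e0); auto).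
destruct L as [[d d0] Hd]; exists d; split; [exact d0 | exact Hd].
Qed.

Lemma continuous3_of_coord (f : R -> R3) (t : R) :
  continuous (fun s => X1 (f s)) t -> continuous (fun s => X2 (f s)) t ->
  continuous (fun s => X3 (f s)) t ->
  forall e, 0 < e -> exists d, 0 < d /\ forall u, Rabs (u - t) < d -> edist (f u) (f t) < e.
Proof.
intros c1 c2 c3 e e0; assert (e3 : 0 < e / 3) by lra.
destruct (continuous_eps _ _ c1 _ e3) as [d1 [? H1]].
destruct (continuous_eps _ _ c2 _ e3) as [d2 [? H2]].
destruct (continuous_eps _ _ c3 _ e3) as [d3 [? H3]].
exists (Rmin d1 (Rmin d2 d3)); split; [now repeat apply Rmin_pos|].
intros u Hu; destruct (lt_Rmin _ _ _ Hu) as [Hu1 Hu']; destruct (lt_Rmin _ _ _ Hu') as [Hu2 Hu3].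
specialize (H1 _ Hu1); specialize (H2 _ Hu2); specialize (H3 _ Hu3).
rewrite (coordE (f u)), (coordE (f t)).
eapply Rle_lt_trans; [apply edist_le_sum | lra].
Qed.

(** By the mean value theorem between [s] and [t] and the continuity of [f'] at [t0]. Both ends
    move, which differentiability at [t0] alone would not allow; chords need not start at the base
    point. *)
Lemma strict_derive (f f' : R -> R) (t0 : R) :
  (forall t : R, is_derive f t (f' t)) -> continuous f' t0 ->
  forall e, 0 < e -> exists d, 0 < d /\
    forall s t, Rabs (s - t0) < d -> Rabs (t - t0) < d ->
      Rabs (f s - f t - (s - t) * f' t0) <= e * Rabs (s - t).
Proof.
intros D C e e0; destruct (continuous_eps _ _ C e e0) as [d [d0 Hd]].
exists d; split; trivial; intros s t Hs Ht.
destruct (MVT_gen f t s f') as [c [Hc E]].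
- intros; apply D.
- intros x _; apply continuity_pt_filterlim, (ex_derive_continuous f).
  eexists; apply D.
- rewrite E.
  replace (f' c * (s - t) - (s - t) * f' t0) with ((f' c - f' t0) * (s - t)) by ring.
  rewrite Rabs_mult; apply Rmult_le_compat_r; [apply Rabs_pos|].
  apply Rlt_le, Hd.
  apply Rabs_lt_between in Hs; apply Rabs_lt_between in Ht; apply Rabs_lt_between.
  revert Hc; unfold Rmin, Rmax; destruct (Rle_dec t s); lra.
Qed.

Definition smul (a : R) (p : R3) : R3 := let '(x, y, z) := p in (a * x, a * y, a * z).

Lemma nrm_smul a p : nrm (smul a p) = Rabs a * nrm p.
Proof.
destruct p as [[x y] z]; unfold nrm; simpl.
replace (a * x * (a * x) + a * y * (a * y) + a * z * (a * z))
  with (Rsqr a * (x * x + y * y + z * z)) by (unfold Rsqr; ring).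
rewrite sqrt_mult; [now rewrite sqrt_Rsqr_abs | apply Rle_0_sqr | nra].
Qed.

Lemma dot_smul n a p : dot n (smul a p) = a * dot n p.
Proof. destruct n as [[? ?] ?], p as [[? ?] ?]; simpl; ring. Qed.

Lemma strict_derive3 (f f' : R -> R3) (t0 : R) :
  (forall t : R, is_derive f t (f' t)) -> continuous f' t0 ->
  forall e, 0 < e -> exists d, 0 < d /\
    forall s t, Rabs (s - t0) < d -> Rabs (t - t0) < d ->
      edist (vsub (f s) (f t)) (smul (s - t) (f' t0)) <= e * Rabs (s - t).
Proof.
intros D C e e0; assert (e3 : 0 < e / 3) by lra.
destruct (continuous_coord _ _ C) as [C1 [C2 C3]].
destruct (strict_derive _ _ t0 (fun t => proj1 (is_derive_coord _ _ _ (D t))) C1 _ e3)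
  as [d1 [? H1]].
destruct (strict_derive _ _ t0 (fun t => proj1 (proj2 (is_derive_coord _ _ _ (D t)))) C2 _ e3)
  as [d2 [? H2]].
destruct (strict_derive _ _ t0 (fun t => proj2 (proj2 (is_derive_coord _ _ _ (D t)))) C3 _ e3)
  as [d3 [? H3]].
exists (Rmin d1 (Rmin d2 d3)); split; [now repeat apply Rmin_pos|].
intros s t Hs Ht.
destruct (lt_Rmin _ _ _ Hs) as [Hs1 Hs']; destruct (lt_Rmin _ _ _ Hs') as [Hs2 Hs3].
destruct (lt_Rmin _ _ _ Ht) as [Ht1 Ht']; destruct (lt_Rmin _ _ _ Ht') as [Ht2 Ht3].
specialize (H1 _ _ Hs1 Ht1); specialize (H2 _ _ Hs2 Ht2); specialize (H3 _ _ Hs3 Ht3).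
rewrite (coordE (f s)), (coordE (f t)), (coordE (f' t0)); simpl.
eapply Rle_trans; [apply edist_le_sum | lra].
Qed.

(** In the plane the product vanishes. On the sphere it is bounded by a sum of two terms, each at
    most [e / 2] times the length of the chord. *)
Lemma surface_tangent S p : on_surface S p -> forall e, 0 < e ->
  exists d, 0 < d /\ forall q q', on_surface S q -> on_surface S q' ->
    edist q p < d -> edist q' p < d ->
    Rabs (dot (normal S p) (vsub q q')) <= e * edist q q'.
Proof.
intros Sp e e0; destruct S; simpl.
- exists 1; split; [lra|]; intros [[x y] z] [[x' y'] z'] Sq Sq' _ _; simpl in *.
  replace (0 * (x - x') + 0 * (y - y') + 1 * (z - z')) with 0 by (rewrite Sq, Sq'; ring).
  rewrite Rabs_R0; apply Rmult_le_pos; [lra | apply edist_ge0].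
- exists (e / 2); split; [lra|]; intros q q' Sq Sq' Hq Hq'.
  (* Since [q] and [q'] are unit vectors, the product of [q] with [q - q'] is half the square of the
     chord. *)
  assert (E : dot p (vsub q q') = dot (vsub p q) (vsub q q') + / 2 * dot (vsub q q') (vsub q q')).
  { destruct p as [[? ?] ?], q as [[? ?] ?], q' as [[? ?] ?]; simpl in *; nra. }
  rewrite E, <- nrm_sqr.
  pose proof (cauchy_schwarz (vsub p q) (vsub q q')) as CS.
  fold (edist p q) in *; fold (edist q q') in *.
  rewrite (edist_sym p q) in CS.
  pose proof (edist_triangle q p q') as T; rewrite (edist_sym p q') in T.
  pose proof (edist_ge0 q q'); pose proof (edist_ge0 q p).
  apply Rabs_le_between in CS; apply Rabs_le; split; nra.
Qed.

(** * Curves on the surface *)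

(** The square of a determinant is the Gram determinant, which factors when [b] is orthogonal to [a]
    and [w]. *)
Lemma gram a b w :
  dot a a = 1 -> dot a b = 0 -> dot b w = 0 ->
  dot (cross a b) w * dot (cross a b) w = dot b b * (dot w w - dot a w * dot a w).
Proof.
intros aa ab bw.
transitivity (dot a a * dot b b * dot w w + 2 * dot a b * dot b w * dot a w
  - dot a a * (dot b w * dot b w) - dot b b * (dot a w * dot a w)
  - dot w w * (dot a b * dot a b)).
- destruct a as [[? ?] ?], b as [[? ?] ?], w as [[? ?] ?]; simpl; ring.
- rewrite aa, ab, bw; ring.
Qed.

Lemma same_point_sym {n} (P Q : Fin.t n * R) : same_point P Q -> same_point Q P.
Proof.
intros [E [k Hk]]; split; [easy|]; exists (- k)%Z; rewrite opp_IZR; lra.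
Qed.

Lemma same_point_trans {n} (P Q T : Fin.t n * R) :
  same_point P Q -> same_point Q T -> same_point P T.
Proof.
intros [E [k Hk]] [E' [k' Hk']]; split; [congruence|].
exists (k + k')%Z; rewrite plus_IZR; lra.
Qed.

Lemma list_uniform {A : Type} (Phi : A -> R -> Prop) (l : list A) :
  (forall x d d', 0 < d' <= d -> Phi x d -> Phi x d') ->
  (forall x, In x l -> exists d, 0 < d /\ Phi x d) ->
  exists d, 0 < d /\ forall x, In x l -> Phi x d.
Proof.
intros mono; induction l as [|x l IH]; intros H.
- exists 1; split; [lra | now intros].
- destruct IH as [d [d0 Hd]]; [intros; apply H; now right|].
  destruct (H x (or_introl eq_refl)) as [e [e0 He]].
  pose proof (Rmin_l d e); pose proof (Rmin_r d e); pose proof (Rmin_pos d e d0 e0).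
  exists (Rmin d e); split; trivial.
  intros y [<- | Hy]; [apply (mono x e) | apply (mono y d)]; auto.
Qed.

Section Diagram.

Context (L : diagram).

Notation point := (circle_point L).
Notation surf := (on_surface (dg_surface L)).

Definition pt (P : point) : R3 := dg_curve L (fst P) (snd P).
Definition vel (P : point) : R3 := dg_velocity L (fst P) (snd P).
Definition nu (P : point) : R3 := normal (dg_surface L) (pt P).

(** A normal vector of the curve in the surface, pointing to its left. *)
Definition lnv (P : point) : R3 := cross (nu P) (vel P).

Lemma pt_on_surface P : on_surface (dg_surface L) (pt P).
Proof. apply dg_on_surface. Qed.

Lemma nu_unit P : dot (nu P) (nu P) = 1.
Proof.
pose proof (pt_on_surface P) as H; unfold nu.
destruct (pt P) as [[x y] z], (dg_surface L); simpl in *; nra.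
Qed.

(** Differentiate the equation of the surface along the curve: [z = 0], respectively the sum of the
    squares equal to 1. *)
Lemma nu_vel P : dot (nu P) (vel P) = 0.
Proof.
destruct P as [i t]; unfold nu, vel, pt; simpl.
pose proof (is_derive_coord _ _ _ (dg_derive L i t)) as [D1 [D2 D3]].
pose proof (dg_on_surface L i) as HS.
destruct (dg_surface L); simpl.
- assert (E : is_derive (fun s => X3 (dg_curve L i s)) t 0).
  { apply (is_derive_ext (fun _ => 0)); [| apply (is_derive_const (V := R_NormedModule))].
    intros s; specialize (HS s); destruct (dg_curve L i s) as [[x y] z]; simpl in *.
    now rewrite HS. }
  apply is_derive_unique in E; apply is_derive_unique in D3.
  rewrite D3 in E; destruct (dg_velocity L i t) as [[x y] z]; unfold X3 in E; simpl in *.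
  rewrite E; ring.
- pose (f s := X1 (dg_curve L i s) * X1 (dg_curve L i s) +
    X2 (dg_curve L i s) * X2 (dg_curve L i s) + X3 (dg_curve L i s) * X3 (dg_curve L i s)).
  assert (E : is_derive f t 0).
  { apply (is_derive_ext (fun _ => 1)); [| apply (is_derive_const (V := R_NormedModule))].
    intros s; specialize (HS s); unfold f.
    destruct (dg_curve L i s) as [[x y] z]; unfold X1, X2, X3; simpl in *; nra. }
  assert (M : forall g dg, is_derive g t dg -> is_derive (fun s => g s * g s) t (2 * g t * dg)).
  { intros g dg Hg; replace (2 * g t * dg) with (plus (mult dg (g t)) (mult (g t) dg))
      by (unfold plus, mult; simpl; ring).
    apply (is_derive_mult g g t dg dg); trivial; intros; apply Rmult_comm. }
  pose proof (is_derive_plus (V := R_NormedModule) _ _ t _ _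
    (is_derive_plus (V := R_NormedModule) _ _ t _ _ (M _ _ D1) (M _ _ D2)) (M _ _ D3)) as F.
  change (is_derive f t (plus (plus (2 * X1 (dg_curve L i t) * X1 (dg_velocity L i t))
    (2 * X2 (dg_curve L i t) * X2 (dg_velocity L i t)))
    (2 * X3 (dg_curve L i t) * X3 (dg_velocity L i t)))) in F.
  apply is_derive_unique in E; apply is_derive_unique in F.
  rewrite F in E; unfold plus, X1, X2, X3 in E; simpl in E.
  destruct (dg_curve L i t) as [[x y] z], (dg_velocity L i t) as [[x' y'] z'];
    simpl in *; lra.
Qed.

Lemma vel_pos P : 0 < nrm (vel P).
Proof.
destruct (nrm_ge0 (vel P)) as [? | E]; trivial.
destruct (dg_immersion L (fst P) (snd P)); now apply nrm_eq0.
Qed.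

Lemma nrm_lnv P : nrm (lnv P) = nrm (vel P).
Proof.
unfold nrm; f_equal; unfold lnv.
pose proof (nu_unit P) as U; pose proof (nu_vel P) as V.
transitivity (dot (nu P) (nu P) * dot (vel P) (vel P) - dot (nu P) (vel P) * dot (nu P) (vel P)).
- destruct (nu P) as [[? ?] ?], (vel P) as [[? ?] ?]; simpl; ring.
- rewrite U, V; ring.
Qed.

Lemma lnv_vel P : dot (lnv P) (vel P) = 0.
Proof. unfold lnv; destruct (nu P) as [[? ?] ?], (vel P) as [[? ?] ?]; simpl; ring. Qed.

Lemma curve_continuous i (t : R) : continuous (dg_curve L i) t.
Proof.
apply (ex_derive_continuous (V := prod_NormedModule _
  (prod_NormedModule _ R_NormedModule R_NormedModule) R_NormedModule)).
exists (dg_velocity L i t); apply dg_derive.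
Qed.

Lemma pt_continuous i : continuous3 (fun t => pt (i, t)).
Proof.
intros t; unfold pt; simpl.
pose proof (curve_continuous i t) as C.
destruct (continuous_coord _ _ C) as [C1 [C2 C3]].
now apply continuous3_of_coord.
Qed.

Lemma lnv_continuous i : continuous3 (fun t => lnv (i, t)).
Proof.
intros t; unfold lnv, nu, pt, vel; simpl.
pose proof (curve_continuous i t) as C.
destruct (continuous_coord _ _ C) as [C1 [C2 C3]].
destruct (continuous_coord _ _ (dg_C1 L i t)) as [V1 [V2 V3]].
assert (N : continuous (fun s => X1 (normal (dg_surface L) (dg_curve L i s))) t /\
  continuous (fun s => X2 (normal (dg_surface L) (dg_curve L i s))) t /\
  continuous (fun s => X3 (normal (dg_surface L) (dg_curve L i s))) t).
{ destruct (dg_surface L); simpl; auto.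
  split; [|split]; apply continuous_const. }
destruct N as [N1 [N2 N3]].
assert (K : forall f g h k : R -> R, continuous f t -> continuous g t ->
  continuous h t -> continuous k t -> continuous (fun s => f s * g s - h s * k s) t).
{ intros f g h k cf cg ch ck.
  apply (continuous_minus (V := R_NormedModule) (fun s => f s * g s) (fun s => h s * k s));
    now apply (continuous_mult (K := R_AbsRing)). }
assert (E : forall p q, cross p q = (X2 p * X3 q - X3 p * X2 q, X3 p * X1 q - X1 p * X3 q,
  X1 p * X2 q - X2 p * X1 q)) by (intros [[? ?] ?] [[? ?] ?]; reflexivity).
apply continuous3_of_coord.
- apply (continuous_ext (fun s => X2 (normal (dg_surface L) (dg_curve L i s)) *
    X3 (dg_velocity L i s) - X3 (normal (dg_surface L) (dg_curve L i s)) *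
    X2 (dg_velocity L i s))); [intros s; now rewrite E | now apply K].
- apply (continuous_ext (fun s => X3 (normal (dg_surface L) (dg_curve L i s)) *
    X1 (dg_velocity L i s) - X1 (normal (dg_surface L) (dg_curve L i s)) *
    X3 (dg_velocity L i s))); [intros s; now rewrite E | now apply K].
- apply (continuous_ext (fun s => X1 (normal (dg_surface L) (dg_curve L i s)) *
    X2 (dg_velocity L i s) - X2 (normal (dg_surface L) (dg_curve L i s)) *
    X1 (dg_velocity L i s))); [intros s; now rewrite E | now apply K].
Qed.

Lemma periodic_Z {A : Type} (f : R -> A) : (forall t, f (t + 1) = f t) ->
  forall k t, f (t + IZR k) = f t.
Proof.
intros H.
assert (N : forall n t, f (t + INR n) = f t).
{ induction n as [|n IH]; intros t; [now rewrite Rplus_0_r|].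
  rewrite S_INR, <- Rplus_assoc, H; apply IH. }
intros k t; destruct (Z_le_gt_dec 0 k) as [p | m].
- rewrite <- (Z2Nat.id k) by trivial; rewrite <- INR_IZR_INZ; apply N.
- rewrite <- (N (Z.to_nat (- k)) (t + IZR k)); f_equal.
  rewrite INR_IZR_INZ, Z2Nat.id by lia; rewrite opp_IZR; lra.
Qed.

(** A diagram only postulates that the curve is periodic; the velocity inherits this by uniqueness
    of derivatives. *)
Lemma vel_periodic i t : dg_velocity L i (t + 1) = dg_velocity L i t.
Proof.
assert (D : is_derive (dg_curve L i) t (dg_velocity L i (t + 1))).
{ apply (is_derive_ext (fun s => dg_curve L i (s + 1))); [intros s; apply dg_periodic|].
  rewrite <- (scal_one (dg_velocity L i (t + 1))).
  apply (is_derive_comp (dg_curve L i) (fun s => s + 1)); [apply dg_derive|].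
  change (@one R_AbsRing) with 1; auto_derive; trivial. }
destruct (is_derive_coord _ _ _ D) as [D1 [D2 D3]].
destruct (is_derive_coord _ _ _ (dg_derive L i t)) as [E1 [E2 E3]].
rewrite (coordE (dg_velocity L i (t + 1))), (coordE (dg_velocity L i t)).
apply is_derive_unique in D1, D2, D3, E1, E2, E3.
rewrite <- D1, <- D2, <- D3, <- E1, <- E2, <- E3; reflexivity.
Qed.

Lemma pt_shift i t k : pt (i, t + IZR k) = pt (i, t).
Proof. apply (periodic_Z (dg_curve L i)); intros; apply dg_periodic. Qed.

Lemma vel_shift i t k : vel (i, t + IZR k) = vel (i, t).
Proof. apply (periodic_Z (dg_velocity L i)); intros; apply vel_periodic. Qed.

Lemma same_point_eq P Q : same_point P Q -> pt P = pt Q /\ vel P = vel Q.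
Proof.
destruct P as [i s], Q as [j t]; intros [E [k Hk]]; simpl in *; subst j s.
split; [apply pt_shift | apply vel_shift].
Qed.

(** A short chord is nearly [(s - t)] times [vel P], which is orthogonal to [lnv P] and nonzero
    unless [s = t]. *)
Lemma chord P c : 0 < c -> exists e, 0 < e /\ forall s t,
  Rabs (s - snd P) < e -> Rabs (t - snd P) < e ->
  Rabs (dot (lnv P) (vsub (pt (fst P, s)) (pt (fst P, t)))) <=
    c * edist (pt (fst P, s)) (pt (fst P, t)) /\
  (pt (fst P, s) = pt (fst P, t) -> s = t).
Proof.
intros c0; pose proof (vel_pos P) as v0.
(* The first bound keeps the chord at least half as long as its linear approximation; given that,
   the second limits its component along [lnv P] to [c] times its length. *)
pose (e := Rmin (nrm (vel P) / 2) (c / 2)).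
assert (e0 : 0 < e) by (apply Rmin_pos; lra).
destruct (strict_derive3 _ _ (snd P) (dg_derive L (fst P)) (dg_C1 L (fst P) (snd P)) e e0)
  as [d [d0 Hd]].
exists d; split; trivial; intros s t Hs Ht; specialize (Hd s t Hs Ht).
change (dg_curve L (fst P) s) with (pt (fst P, s)) in Hd.
change (dg_curve L (fst P) t) with (pt (fst P, t)) in Hd.
change (dg_velocity L (fst P) (snd P)) with (vel P) in Hd.
set (w := vsub (pt (fst P, s)) (pt (fst P, t))) in *.
assert (B : nrm (vel P) / 2 * Rabs (s - t) <= edist (pt (fst P, s)) (pt (fst P, t))).
{ change (edist (pt (fst P, s)) (pt (fst P, t))) with (nrm w).
  pose proof (nrm_edist (smul (s - t) (vel P)) w) as T.
  rewrite nrm_smul, edist_sym in T.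
  pose proof (Rmin_l (nrm (vel P) / 2) (c / 2)); fold e in H.
  pose proof (Rabs_pos (s - t)); nra. }
split.
- pose proof (cauchy_schwarz (lnv P) (vsub w (smul (s - t) (vel P)))) as CS.
  rewrite dot_vsub_r, dot_smul, lnv_vel, Rmult_0_r, Rminus_0_r, nrm_lnv in CS.
  fold (edist w (smul (s - t) (vel P))) in CS.
  pose proof (Rmin_r (nrm (vel P) / 2) (c / 2)); fold e in H.
  pose proof (Rabs_pos (s - t)).
  assert (nrm (vel P) * edist w (smul (s - t) (vel P)) <= nrm (vel P) * (e * Rabs (s - t)))
    by (apply Rmult_le_compat_l; lra).
  assert (nrm (vel P) * (e * Rabs (s - t)) <= nrm (vel P) * (c / 2 * Rabs (s - t)))
    by (apply Rmult_le_compat_l; [lra | apply Rmult_le_compat_r; lra]).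
  nra.
- intros E; rewrite E, edist_refl in B.
  pose proof (Rabs_pos (s - t)).
  assert (Z : Rabs (s - t) = 0) by nra.
  destruct (Req_dec (s - t) 0); [lra|]; now apply Rabs_no_R0 in Z.
Qed.

(** By the intermediate value theorem [q - pt (fst P, s)] is orthogonal to the
    velocity at [P] for some [s]; being almost tangent to the surface, it is then
    almost parallel to [lnv P]. *)
Lemma foot P h : 0 < h -> exists d, 0 < d /\ forall q,
  on_surface (dg_surface L) q -> edist q (pt P) < d ->
  exists s, Rabs (s - snd P) < h /\
    nrm (lnv P) / 2 * edist q (pt (fst P, s)) <=
      Rabs (dot (lnv P) (vsub q (pt (fst P, s)))).
Proof.
intros h0; pose proof (vel_pos P) as v0.
assert (e0 : 0 < nrm (vel P) / 2) by lra.
destruct (strict_derive3 _ _ (snd P) (dg_derive L (fst P)) (dg_C1 L (fst P) (snd P)) _ e0)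
  as [d1 [d10 H1]].
assert (half : 0 < 1 / 2) by lra.
destruct (surface_tangent _ _ (pt_on_surface P) _ half) as [d2 [d20 H2]].
destruct (pt_continuous (fst P) (snd P) d2 d20) as [d3 [d30 H3]].
pose (m := Rmin h (Rmin d1 d3)).
assert (m0 : 0 < m) by (repeat apply Rmin_pos; trivial).
assert (mm : m / 2 < m) by lra.
destruct (lt_Rmin _ _ _ mm) as [mh mm']; destruct (lt_Rmin _ _ _ mm') as [md1 md3].
(* At the parameters [snd P - m / 2] and [snd P + m / 2] the linear term of [F] has size [m / 2]
   times the squared speed. The linearization error is at most half of that and the term from [q]
   less than half, so [F] has opposite signs at the two ends. *)
exists (Rmin d2 (m / 2 * (nrm (vel P) / 2))); split.
{ apply Rmin_pos; trivial; apply Rmult_lt_0_compat; lra. }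
intros q Sq Hq; destruct (lt_Rmin _ _ _ Hq) as [Hq2 Hqm].
pose (F s := dot (vel P) (vsub q (pt (fst P, s)))).
assert (FE : forall s, F s = dot (vel P) (vsub q (pt P))
   - dot (vel P) (vsub (vsub (pt (fst P, s)) (pt P)) (smul (s - snd P) (vel P)))
   - (s - snd P) * (nrm (vel P) * nrm (vel P))).
{ intros s; unfold F; rewrite nrm_sqr, !dot_vsub_r, dot_smul; ring. }
assert (FF : forall u s, F u - F s = dot (vel P) (vsub (pt (fst P, s)) (pt (fst P, u)))).
{ intros u s; unfold F; rewrite !dot_vsub_r; ring. }
pose proof (cauchy_schwarz (vel P) (vsub q (pt P))) as CS1.
fold (edist q (pt P)) in CS1.
assert (CS : forall s, Rabs (s - snd P) < d1 ->
   Rabs (dot (vel P) (vsub (vsub (pt (fst P, s)) (pt P)) (smul (s - snd P) (vel P))))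
     <= nrm (vel P) * (nrm (vel P) / 2 * Rabs (s - snd P))).
{ intros s Hs; eapply Rle_trans; [apply cauchy_schwarz|].
  apply Rmult_le_compat_l; [lra|].
  apply (H1 s (snd P)); trivial; now rewrite Rminus_diag, Rabs_R0. }
assert (qv : nrm (vel P) * edist q (pt P) < nrm (vel P) * (m / 2 * (nrm (vel P) / 2)))
  by now apply Rmult_lt_compat_l.
assert (m20 : 0 < m / 2) by lra.
assert (vv : 0 < nrm (vel P) * nrm (vel P)) by nra.
destruct (IVT_cor F (snd P - m / 2) (snd P + m / 2)) as [s [Hs Fs]].
- intros s; apply continuity_pt_locally; intros [e e_pos]; simpl.
  assert (e1 : 0 < e / nrm (vel P)) by now apply Rdiv_lt_0_compat.
  destruct (pt_continuous (fst P) s _ e1) as [d [d0 Hd]].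
  exists (mkposreal d d0); intros u Hu; specialize (Hd u Hu); simpl in Hd.
  rewrite FF.
  eapply Rle_lt_trans; [apply cauchy_schwarz|].
  change (nrm (vel P) * edist (pt (fst P, s)) (pt (fst P, u)) < e); rewrite edist_sym.
  apply (Rmult_lt_compat_l (nrm (vel P))) in Hd; trivial.
  replace (nrm (vel P) * (e / nrm (vel P))) with e in Hd by (field; lra); trivial.
- lra.
- assert (F1 : 0 <= F (snd P - m / 2)).
  { rewrite FE; set (s := snd P - m / 2).
    assert (Es : Rabs (s - snd P) = m / 2)
      by (unfold s; rewrite Rabs_left; lra).
    specialize (CS s); rewrite Es in CS; specialize (CS md1).
    apply Rabs_le_between in CS; apply Rabs_le_between in CS1.
    replace (s - snd P) with (- (m / 2)) in CS |- * by (unfold s; ring); lra. }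
  assert (F2 : F (snd P + m / 2) <= 0).
  { rewrite FE; set (s := snd P + m / 2).
    assert (Es : Rabs (s - snd P) = m / 2)
      by (unfold s; rewrite Rabs_right; lra).
    specialize (CS s); rewrite Es in CS; specialize (CS md1).
    apply Rabs_le_between in CS; apply Rabs_le_between in CS1.
    replace (s - snd P) with (m / 2) in CS |- * by (unfold s; ring); lra. }
  nra.
- assert (sm : Rabs (s - snd P) <= m / 2) by (apply Rabs_le; lra).
  exists s; split; [lra|].
  set (w := vsub q (pt (fst P, s))) in *.
  assert (T : Rabs (dot (nu P) w) <= 1 / 2 * nrm w).
  { apply H2; trivial; [apply dg_on_surface | apply H3; lra]. }
  (* [w] has no component along the velocity and at most half its length along the normal, so three
     quarters of its squared length remain along [lnv P]; one quarter would do. *)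
  pose proof (gram (nu P) (vel P) w (nu_unit P) (nu_vel P) Fs) as G.
  fold (lnv P) in G; rewrite <- !nrm_sqr, <- nrm_lnv in G.
  change (edist q (pt (fst P, s))) with (nrm w).
  pose proof (nrm_ge0 w) as w0; pose proof (nrm_ge0 (lnv P)) as n0.
  rewrite <- (Rabs_pos_eq (nrm (lnv P) / 2 * nrm w)) by nra.
  apply Rsqr_le_abs_0; unfold Rsqr; rewrite G.
  apply Rabs_le_between in T.
  assert (dot (nu P) w * dot (nu P) w <= 1 / 4 * (nrm w * nrm w)) by nra.
  assert (N2 : 0 <= nrm (lnv P) * nrm (lnv P)) by nra.
  assert (nrm (lnv P) * nrm (lnv P) * (1 / 4 * (nrm w * nrm w)) <=
    nrm (lnv P) * nrm (lnv P) * (nrm w * nrm w - dot (nu P) w * dot (nu P) w)).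
  { apply Rmult_le_compat_l; nra. }
  nra.
Qed.

(** [c] is the slope of the cones that define the sides of the strand through [P]
    (see [side]) and [e] its length. The curve itself stays outside the cones, but
    by the last condition the other strand at a double point runs inside them. *)
Definition nice (P : point) (c e : R) : Prop :=
  0 < c /\ 0 < e /\ 8 * c <= nrm (lnv P) /\
  (forall s t, Rabs (s - snd P) < 2 * e -> Rabs (t - snd P) < 2 * e ->
     Rabs (dot (lnv P) (vsub (pt (fst P, s)) (pt (fst P, t)))) <=
       c * edist (pt (fst P, s)) (pt (fst P, t)) /\
     (pt (fst P, s) = pt (fst P, t) -> s = t)) /\
  (forall s, Rabs (s - snd P) < e -> edist (lnv (fst P, s)) (lnv P) <= c) /\
  (forall Q, meet (dg_curve L) P Q -> c * nrm (vel Q) < Rabs (dot (lnv P) (vel Q))).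

Lemma nice_exists P : exists ce : R * R, nice P (fst ce) (snd ce).
Proof.
pose proof (vel_pos P) as v0; rewrite <- nrm_lnv in v0.
assert (Hc : exists c, 0 < c /\ 8 * c <= nrm (lnv P) /\
  forall Q, meet (dg_curve L) P Q -> c * nrm (vel Q) < Rabs (dot (lnv P) (vel Q))).
{ destruct (classic (exists Q, meet (dg_curve L) P Q)) as [[Q HQ] | N].
  - assert (T : 0 < Rabs (dot (lnv P) (vel Q))).
    { apply Rabs_pos_lt; unfold lnv; rewrite <- det3_dot; now apply dg_transverse. }
    pose proof (vel_pos Q) as w0.
    (* Half of the largest admissible slope, which makes the last inequality of [nice] strict. The
       absence of triple points makes one [Q] speak for all. *)
    pose (r := Rabs (dot (lnv P) (vel Q)) / (2 * nrm (vel Q))).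
    assert (r0 : 0 < r) by (apply Rdiv_lt_0_compat; lra).
    exists (Rmin (nrm (lnv P) / 8) r).
    pose proof (Rmin_l (nrm (lnv P) / 8) r); pose proof (Rmin_r (nrm (lnv P) / 8) r).
    split; [apply Rmin_pos; lra|]; split; [lra|].
    intros Q' HQ'.
    destruct (same_point_eq _ _ (dg_no_triple L _ _ _ HQ HQ')) as [_ <-].
    apply Rle_lt_trans with (r * nrm (vel Q)); [apply Rmult_le_compat_r; lra|].
    unfold r; replace (Rabs (dot (lnv P) (vel Q)) / (2 * nrm (vel Q)) * nrm (vel Q))
      with (Rabs (dot (lnv P) (vel Q)) / 2) by (field; lra); lra.
  - exists (nrm (lnv P) / 8); split; [lra|]; split; [lra|].
    intros Q HQ; destruct N; now exists Q. }
destruct Hc as [c [c0 [c8 cQ]]].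
destruct (chord P c c0) as [e1 [e10 H1]].
destruct (lnv_continuous (fst P) (snd P) c c0) as [e2 [e20 H2]].
(* Halved because [nice] imposes the chord condition on a window of twice the length. *)
exists (c, Rmin (e1 / 2) e2); simpl.
assert (e0 : 0 < Rmin (e1 / 2) e2) by (apply Rmin_pos; lra).
pose proof (Rmin_l (e1 / 2) e2); pose proof (Rmin_r (e1 / 2) e2).
repeat split; trivial.
- apply H1; lra.
- apply H1; lra.
- intros s Hs; apply Rlt_le; destruct P as [i t]; apply H2; simpl in *; lra.
Qed.

Definition nice_pair P := constructive_indefinite_description _ (nice_exists P).
Definition ratio (P : point) : R := fst (proj1_sig (nice_pair P)).
Definition radius (P : point) : R := snd (proj1_sig (nice_pair P)).

Lemma niceP P : nice P (ratio P) (radius P).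
Proof. exact (proj2_sig (nice_pair P)). Qed.

(** ** Sides of a strand *)

(** Strictly left of the strand through [P] for [sg = 1], right for [sg = -1]. *)
Definition side (sg : R) (P : point) (q : R3) : Prop :=
  exists s, Rabs (s - snd P) < radius P /\
    ratio P * edist q (pt (fst P, s)) < sg * dot (lnv P) (vsub q (pt (fst P, s))).

Lemma side_open sg P q : sg * sg = 1 -> side sg P q ->
  exists d, 0 < d /\ forall z, edist z q < d -> side sg P z.
Proof.
intros sg1 [s [Hs H]].
destruct (niceP P) as [c0 _].
pose proof (nrm_ge0 (lnv P)) as n0.
(* The slack [g] in the cone inequality is Lipschitz in [q] with constant [m]; the apex [s] is
   kept. *)
set (g := sg * dot (lnv P) (vsub q (pt (fst P, s))) - ratio P * edist q (pt (fst P, s))).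
set (m := nrm (lnv P) + ratio P).
assert (m0 : 0 < m) by (unfold m; lra).
exists (g / m); split; [apply Rdiv_lt_0_compat; unfold g; lra|].
intros z Hz; exists s; split; trivial.
apply (Rmult_lt_compat_l m) in Hz; trivial.
replace (m * (g / m)) with g in Hz by (field; lra).
pose proof (cauchy_schwarz (lnv P) (vsub z q)) as CS; fold (edist z q) in CS.
apply Rabs_le_between in CS.
pose proof (edist_triangle z q (pt (fst P, s))) as T.
apply (Rmult_le_compat_l (ratio P)) in T; [|lra].
assert (E : dot (lnv P) (vsub z (pt (fst P, s))) =
  dot (lnv P) (vsub z q) + dot (lnv P) (vsub q (pt (fst P, s))))
  by (rewrite !dot_vsub_r; ring).
rewrite E; unfold g, m in Hz.
assert (sg = 1 \/ sg = -1) as [-> | ->] by (destruct (Rle_or_lt 0 sg); [left | right]; nra);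
  lra.
Qed.

(** Adding the two cone inequalities makes the chord between the apexes too steep: its component
    along [lnv P] would exceed [ratio P] times the length of a detour through [q]. *)
Lemma side_disjoint P q : side 1 P q -> side (-1) P q -> False.
Proof.
intros [s [Hs H]] [t [Ht H']].
destruct (niceP P) as [c0 [r0 [_ [C _]]]].
destruct (C t s) as [B _]; try lra.
apply Rabs_le_between in B.
pose proof (edist_triangle (pt (fst P, t)) q (pt (fst P, s))) as T.
rewrite (edist_sym (pt (fst P, t)) q) in T.
apply (Rmult_le_compat_l (ratio P)) in T; [|lra].
rewrite !dot_vsub_r in *; lra.
Qed.

Lemma side_curve sg P s : sg * sg = 1 -> Rabs (s - snd P) < radius P ->
  ~ side sg P (pt (fst P, s)).
Proof.
intros sg1 Hs [t [Ht H]].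
destruct (niceP P) as [c0 [r0 [_ [C _]]]].
destruct (C s t) as [B _]; try lra.
apply Rabs_le_between in B.
assert (sg = 1 \/ sg = -1) as [-> | ->] by (destruct (Rle_or_lt 0 sg); [left | right]; nra);
  lra.
Qed.

Definition lft (P : point) (q : R3) : Z :=
  if excluded_middle_informative (side 1 P q) then 1%Z else 0%Z.

Lemma lft1 P q : side 1 P q -> lft P q = 1%Z.
Proof. unfold lft; now destruct (excluded_middle_informative (side 1 P q)). Qed.

Lemma lft0 P q : ~ side 1 P q -> lft P q = 0%Z.
Proof. unfold lft; now destruct (excluded_middle_informative (side 1 P q)). Qed.

Lemma lft_right P q : side (-1) P q -> lft P q = 0%Z.
Proof. intros H; apply lft0; intros H'; exact (side_disjoint P q H' H). Qed.

Definition near (P Q : point) : Prop :=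
  fst Q = fst P /\ exists k : Z, Rabs (snd Q + IZR k - snd P) < radius P.

Definition loc_const (q : R3) (phi : R3 -> Z) : Prop :=
  exists (k : Z) (d : R), 0 < d /\ forall z, surf z -> edist z q < d -> phi z = k.

Lemma loc_const_plus q phi psi :
  loc_const q phi -> loc_const q psi -> loc_const q (fun z => phi z + psi z)%Z.
Proof.
intros [k [d [d0 H]]] [k' [d' [d0' H']]].
exists (k + k')%Z, (Rmin d d'); split; [now apply Rmin_pos|].
intros z Sz Hz; destruct (lt_Rmin _ _ _ Hz); rewrite H, H'; trivial.
Qed.

Lemma loc_const_ext q phi psi :
  (forall z, phi z = psi z) -> loc_const q phi -> loc_const q psi.
Proof.
intros E [k [d [d0 H]]]; exists k, d; split; trivial; intros; rewrite <- E; auto.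
Qed.

Lemma lnv_eq P Q : same_point P Q -> lnv P = lnv Q.
Proof.
intros H; destruct (same_point_eq P Q H) as [E F].
unfold lnv, nu; now rewrite E, F.
Qed.

(** Near [pt Q] both counts are decided by one foot of [z] on the common stretch of curve. From
    there [z] is steep with respect to [lnv Q], hence also to the nearby vector [lnv P], with the
    same sign. *)
Lemma lft_hit P Q : near P Q -> loc_const (pt Q) (fun z => lft P z - lft Q z)%Z.
Proof.
destruct P as [i t], Q as [j t1]; intros [E [k Hk]]; simpl in E, Hk; subst j.
destruct (niceP (i, t)) as [c0 [r0 [c8 [_ [N _]]]]].
destruct (niceP (i, t1)) as [c0' [r0' [c8' _]]].
(* Keeps the foot within the windows of both strands. *)
set (h := Rmin (radius (i, t1)) (radius (i, t) - Rabs (t1 + IZR k - t))).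
assert (h0 : 0 < h) by (apply Rmin_pos; lra).
destruct (foot (i, t1) h h0) as [d [d0 Hd]].
exists 0%Z, d; split; trivial; intros z Sz Hz.
destruct (Hd z Sz Hz) as [s [Hs F]]; simpl in Hs, F.
destruct (lt_Rmin _ _ _ Hs) as [Hs1 Hs2].
assert (Hs3 : Rabs (s + IZR k - t) < radius (i, t)).
{ replace (s + IZR k - t) with ((s - t1) + (t1 + IZR k - t)) by ring.
  eapply Rle_lt_trans; [apply Rabs_triang | lra]. }
destruct (Req_dec (edist z (pt (i, s))) 0) as [Z | NZ].
- apply edist_eq0 in Z; subst z.
  rewrite !lft0; trivial.
  + apply (side_curve 1 (i, t1)); simpl; trivial; ring.
  + rewrite <- (pt_shift i s k); apply (side_curve 1 (i, t)); simpl; trivial; ring.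
- pose proof (edist_ge0 z (pt (i, s))) as e0.
  assert (e1 : 0 < edist z (pt (i, s))) by lra.
  specialize (N (t1 + IZR k) Hk); simpl in N.
  assert (El : lnv (i, t1 + IZR k) = lnv (i, t1))
    by (apply lnv_eq; split; simpl; trivial; now exists k).
  rewrite El in N.
  pose proof (nrm_edist (lnv (i, t)) (lnv (i, t1))) as T; rewrite edist_sym in T.
  pose proof (cauchy_schwarz (vsub (lnv (i, t1)) (lnv (i, t))) (vsub z (pt (i, s)))) as CS.
  fold (edist z (pt (i, s))) in CS; fold (edist (lnv (i, t1)) (lnv (i, t))) in CS.
  rewrite dot_vsub_l in CS; apply Rabs_le_between in CS.
  assert (B : edist (lnv (i, t1)) (lnv (i, t)) * edist z (pt (i, s))
    <= ratio (i, t) * edist z (pt (i, s))) by (apply Rmult_le_compat_r; lra).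
  (* From [8 * c <= nrm (lnv P)], turning the normal costs one [c] in its length and another in the
     product with [z - pt (i, s)]. What remains is 5/2 of [c], above the required slope. *)
  assert (B1 : 7 / 2 * ratio (i, t) * edist z (pt (i, s)) <=
    nrm (lnv (i, t1)) / 2 * edist z (pt (i, s))) by (apply Rmult_le_compat_r; lra).
  assert (B2 : 4 * ratio (i, t1) * edist z (pt (i, s)) <=
    nrm (lnv (i, t1)) / 2 * edist z (pt (i, s))) by (apply Rmult_le_compat_r; lra).
  assert (0 < ratio (i, t) * edist z (pt (i, s))) by now apply Rmult_lt_0_compat.
  assert (0 < ratio (i, t1) * edist z (pt (i, s))) by now apply Rmult_lt_0_compat.
  destruct (Rle_or_lt 0 (dot (lnv (i, t1)) (vsub z (pt (i, s))))) as [p | m].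
  + rewrite Rabs_pos_eq in F by trivial.
    rewrite !lft1; trivial.
    * exists s; simpl; split; trivial; lra.
    * exists (s + IZR k); simpl; split; trivial; rewrite pt_shift; lra.
  + rewrite Rabs_left in F by trivial.
    rewrite !lft_right; trivial.
    * exists s; simpl; split; trivial; lra.
    * exists (s + IZR k); simpl; split; trivial; rewrite pt_shift; lra.
Qed.

(** Off the strand, the segment from a foot to [q] lies in a left or a right cone, and both sides
    are open. *)
Lemma lft_miss P : exists d, 0 < d /\ forall q, surf q -> edist q (pt P) < d ->
  (forall s, Rabs (s - snd P) < radius P -> pt (fst P, s) <> q) ->
  loc_const q (lft P).
Proof.
destruct (niceP P) as [c0 [r0 [c8 _]]].
destruct (foot P (radius P) r0) as [d [d0 Hd]].
exists d; split; trivial; intros q Sq Hq M.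
destruct (Hd q Sq Hq) as [s [Hs F]].
assert (e0 : 0 < edist q (pt (fst P, s))).
{ apply edist_pos; intros E; now apply (M s Hs). }
assert (B : 4 * ratio P * edist q (pt (fst P, s)) <=
  nrm (lnv P) / 2 * edist q (pt (fst P, s))) by (apply Rmult_le_compat_r; lra).
assert (0 < ratio P * edist q (pt (fst P, s))) by now apply Rmult_lt_0_compat.
destruct (Rle_or_lt 0 (dot (lnv P) (vsub q (pt (fst P, s))))) as [p | m].
- rewrite Rabs_pos_eq in F by trivial.
  destruct (side_open 1 P q) as [e [e1 He]]; [ring | exists s; split; trivial; lra|].
  exists 1%Z, e; split; trivial; intros; apply lft1; auto.
- rewrite Rabs_left in F by trivial.
  destruct (side_open (-1) P q) as [e [e1 He]]; [ring | exists s; split; trivial; lra|].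
  exists 0%Z, e; split; trivial; intros; apply lft_right; auto.
Qed.

Lemma near_same_point P Q Q' : same_point Q Q' -> near P Q -> near P Q'.
Proof.
destruct P as [i t], Q as [j s], Q' as [j' s'].
intros [E [m Hm]] [E' [k Hk]]; simpl in *; split; simpl; [congruence|].
exists (m + k)%Z; rewrite plus_IZR.
now replace (s' + (IZR m + IZR k) - t) with (s + IZR k - t) by (rewrite Hm; ring).
Qed.

Lemma near_injective P Q Q' : near P Q -> near P Q' -> pt Q = pt Q' -> same_point Q Q'.
Proof.
destruct P as [i t], Q as [j s], Q' as [j' s'].
intros [E [k Hk]] [E' [k' Hk']] H; simpl in *; subst j j'.
destruct (niceP (i, t)) as [_ [r0 [_ [C _]]]]; simpl in C.
destruct (C (s + IZR k) (s' + IZR k')) as [_ I]; try lra.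
rewrite !pt_shift in I; specialize (I H).
split; trivial; exists (k' - k)%Z; simpl; rewrite minus_IZR; lra.
Qed.

(** Up to a period the parameters of [P] and [P'] differ by less than the sum of the radii, at most
    twice the larger one. Hence the injectivity on the doubled window in [nice]. *)
Lemma near_disjoint P P' Q : near P Q -> near P' Q -> pt P = pt P' -> same_point P P'.
Proof.
assert (W : forall P P', radius P' <= radius P -> near P Q -> near P' Q ->
  pt P = pt P' -> same_point P P').
{ clear P P'; intros [i t] [i' t'] r; destruct Q as [j s].
  intros [E [k Hk]] [E' [k' Hk']] H; simpl in *; subst i i'.
  destruct (niceP (j, t)) as [_ [r0 [_ [C _]]]]; simpl in C.
  destruct (C t (t' + IZR (k - k'))) as [_ I].
  - rewrite Rminus_diag, Rabs_R0; lra.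
  - rewrite minus_IZR.
    replace (t' + (IZR k - IZR k') - t) with
      ((s + IZR k - t) + - (s + IZR k' - t')) by ring.
    eapply Rle_lt_trans; [apply Rabs_triang | rewrite Rabs_Ropp; lra].
  - rewrite !pt_shift in I; specialize (I H).
    split; trivial; now exists (k - k')%Z. }
intros N N' E; destruct (Rle_or_lt (radius P') (radius P)).
- now apply W.
- apply same_point_sym, W; trivial; lra || easy.
Qed.

(** * Strands through a point and the local index *)

Definition standard (P : point) : Prop := 0 <= snd P < 1.

Lemma standard_exists (P : point) : exists Q, same_point P Q /\ standard Q.
Proof.
destruct P as [i t]; exists (i, frac_part t); split.
- split; trivial; exists (Int_part t); simpl; unfold frac_part; ring.
- destruct (base_fp t); split; simpl; lra.
Qed.

Lemma standard_unique (P Q : point) : same_point P Q -> standard P -> standard Q -> P = Q.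
Proof.
destruct P as [i s], Q as [j t]; intros [E [k Hk]] [? ?] [? ?]; simpl in *.
assert (k = 0%Z) as ->.
{ assert (- 1 < k < 1)%Z; [|lia]; split; apply lt_IZR; lra. }
subst; f_equal; lra.
Qed.

(** Without triple points there are at most two; standard representatives prevent counting a strand
    once per period. *)
Lemma strands_exist p : exists l, NoDup l /\ forall P, In P l <-> pt P = p /\ standard P.
Proof.
destruct (classic (exists P, pt P = p /\ standard P)) as [[P [HP SP]] | N].
- destruct (classic (exists Q, Q <> P /\ pt Q = p /\ standard Q)) as [[Q [QP [HQ SQ]]] | N].
  + assert (M : meet (dg_curve L) P Q).
    { split; [exact (eq_trans HP (eq_sym HQ))|].
      intros S; now destruct QP; symmetry; apply standard_unique. }
    exists (P :: Q :: nil); split.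
    * constructor; [|repeat constructor]; simpl; intuition.
    * intros T; simpl; split; [intros [<- | [<- | []]]; auto|].
      intros [HT ST]; destruct (classic (same_point P T)) as [S | S].
      -- left; now apply standard_unique.
      -- right; left; apply standard_unique; trivial.
         apply (dg_no_triple L P); trivial; split; trivial.
         exact (eq_trans HP (eq_sym HT)).
  + exists (P :: nil); split; [repeat constructor; simpl; intuition|].
    intros T; simpl; split; [intros [<- | []]; auto|].
    intros [HT ST]; left; apply NNPP; intros TP; apply N; exists T; auto.
- exists nil; split; [constructor|].
  intros T; split; [easy|]; intros H; apply N; now exists T.
Qed.

Definition strands p := proj1_sig (constructive_indefinite_description _ (strands_exist p)).

Lemma strands_NoDup p : NoDup (strands p).
Proof. apply (proj2_sig (constructive_indefinite_description _ (strands_exist p))). Qed.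

Lemma in_strands p P : In P (strands p) <-> pt P = p /\ standard P.
Proof. apply (proj2_sig (constructive_indefinite_description _ (strands_exist p))). Qed.

Definition left_sum (l : list point) (q : R3) : Z :=
  fold_right (fun P a => lft P q + a)%Z 0%Z l.

Lemma left_sum_cat l1 P l2 q :
  left_sum (l1 ++ P :: l2) q = (lft P q + left_sum (l1 ++ l2) q)%Z.
Proof. induction l1; simpl in *; lia. Qed.

(** [near] matches every strand through [q] with exactly one in [lp], and distinct ones with
    distinct ones. A matched pair contributes a locally constant difference, an unmatched strand of
    [lp] a locally constant count. *)
Lemma left_sum_loc_const q lp : forall lq, NoDup lp -> NoDup lq ->
  (forall P Q, In P lp -> In Q lq -> near P Q -> loc_const q (fun z => lft P z - lft Q z)%Z) ->
  (forall P, In P lp -> (forall Q, In Q lq -> ~ near P Q) -> loc_const q (lft P)) ->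
  (forall Q, In Q lq -> exists P, In P lp /\ near P Q) ->
  (forall P P' Q, In P lp -> In P' lp -> In Q lq -> near P Q -> near P' Q -> P = P') ->
  (forall P Q Q', In P lp -> In Q lq -> In Q' lq -> near P Q -> near P Q' -> Q = Q') ->
  loc_const q (fun z => left_sum lp z - left_sum lq z)%Z.
Proof.
induction lp as [|P lp IH]; intros lq Np Nq hit miss cov dis inj.
- destruct lq as [|Q lq].
  + exists 0%Z, 1; split; [lra | trivial].
  + destruct (cov Q (or_introl eq_refl)) as [P [[] _]].
- apply NoDup_cons_iff in Np; destruct Np as [nP Np].
  destruct (classic (exists Q, In Q lq /\ near P Q)) as [[Q [HQ PQ]] | N].
  + destruct (in_split Q lq HQ) as [l1 [l2 ->]].
    assert (sub : forall T, In T (l1 ++ l2) -> In T (l1 ++ Q :: l2)).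
    { intros T HT; apply in_app_iff in HT; apply in_app_iff; simpl; tauto. }
    pose proof (NoDup_remove_1 _ _ _ Nq) as Nq1; pose proof (NoDup_remove_2 _ _ _ Nq) as Nq2.
    apply (loc_const_ext q (fun z => (lft P z - lft Q z) +
      (left_sum lp z - left_sum (l1 ++ l2) z))%Z).
    { intros z; rewrite left_sum_cat; simpl; lia. }
    apply loc_const_plus; [apply hit; simpl; auto|].
    apply IH; trivial.
    * intros P' Q' HP' HQ'; apply hit; simpl; auto.
    * intros P' HP' M; apply miss; [now right|]; intros Q' HQ' N'.
      apply in_app_iff in HQ'; simpl in HQ'.
      destruct (classic (Q' = Q)) as [-> | D].
      -- assert (P' = P) as -> by (apply (dis P' P Q); simpl; auto); easy.
      -- apply (M Q'); trivial; apply in_app_iff.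
         destruct HQ' as [? | [? | ?]]; auto; now destruct D.
    * intros Q' HQ'; destruct (cov Q' (sub _ HQ')) as [P' [[<- | HP'] N']].
      -- assert (Q' = Q) as -> by (apply (inj P Q' Q); simpl; auto); easy.
      -- now exists P'.
    * intros P1 P2 Q' ? ? ?; apply dis; simpl; auto.
    * intros P1 Q1 Q2 ? ? ?; apply inj; simpl; auto.
  + apply (loc_const_ext q (fun z => lft P z + (left_sum lp z - left_sum lq z))%Z).
    { intros z; simpl; lia. }
    apply loc_const_plus.
    * apply miss; [now left|]; intros Q HQ PQ; apply N; now exists Q.
    * apply IH; trivial.
      -- intros P' Q' HP' HQ'; apply hit; simpl; auto.
      -- intros P' HP'; apply miss; simpl; auto.
      -- intros Q' HQ'; destruct (cov Q' HQ') as [P' [[<- | HP'] N']].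
         ++ destruct N; now exists Q'.
         ++ now exists P'.
      -- intros P1 P2 Q' ? ? ?; apply dis; simpl; auto.
      -- intros P1 Q1 Q2 ?; apply inj; simpl; auto.
Qed.

(** Compactness of the finitely many circles: Cousin's lemma on a closed period, then a minimum over
    the circles. *)
Lemma standard_uniform (Phi : point -> R -> Prop) :
  (forall P d d', 0 < d' <= d -> Phi P d -> Phi P d') ->
  (forall i t, exists d e, 0 < d /\ 0 < e /\
     forall s, Rabs (s - t) < e -> Phi (i, s) d) ->
  exists d, 0 < d /\ forall P, standard P -> Phi P d.
Proof.
intros mono loc.
destruct (Fin_Finite (dg_n L)) as [l Hl].
destruct (list_uniform (fun i d => forall t, 0 <= t <= 1 -> Phi (i, t) d) l) as [d [d0 Hd]].
- intros i d d' dd H t Ht; apply (mono _ d); auto.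
- intros i _.
  apply (interval_induction (fun u v => exists d, 0 < d /\ 
    forall t, u <= t <= v -> Phi (i, t) d)); [lra | |].
  + intros x y z _ [d [d0 H]] [d' [d0' H']].
    pose proof (Rmin_l d d'); pose proof (Rmin_r d d').
    pose proof (Rmin_pos d d' d0 d0').
    exists (Rmin d d'); split; trivial; intros t Ht.
    destruct (Rle_or_lt t y).
    * apply (mono _ d); [lra|]; apply H; lra.
    * apply (mono _ d'); [lra|]; apply H'; lra.
  + intros x _; destruct (loc i x) as [d [e [d0 [e0 H]]]].
    exists e; split; trivial; intros u v ux xv uv.
    exists d; split; trivial; intros t Ht; apply H; apply Rabs_lt_between; lra.
- exists d; split; trivial; intros [i t] [? ?]; apply Hd; [apply Hl | simpl in *; lra].
Qed.

(** By compactness, the part of the curves outside the windows of the strands through [p] keeps a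
    positive distance from [p]. *)
Lemma strands_near p : exists d, 0 < d /\
  forall Q, edist (pt Q) p < d -> exists P, In P (strands p) /\ near P Q.
Proof.
destruct (standard_uniform (fun Q d => edist (pt Q) p < d ->
  exists P, In P (strands p) /\ near P Q)) as [d [d0 Hd]].
- intros P d d' dd H Hd; apply H; lra.
- intros i t; destruct (classic (pt (i, t) = p)) as [E | N].
  + destruct (standard_exists (i, t)) as [P [S SP]].
    assert (HP : In P (strands p)).
    { apply in_strands; split; trivial.
      now rewrite <- E; symmetry; apply same_point_eq. }
    destruct (niceP P) as [_ [r0 _]].
    exists 1, (radius P); split; [lra|]; split; trivial.
    intros s Hs _; exists P; split; trivial.
    destruct P as [j t']; destruct S as [Ej [k Hk]]; simpl in Ej, Hk; subst j.
    split; trivial; exists (- k)%Z; simpl; rewrite opp_IZR.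
    now replace (s + - IZR k - t') with (s - t) by (rewrite Hk; ring).
  + apply edist_pos in N.
    assert (N2 : 0 < edist (pt (i, t)) p / 2) by lra.
    destruct (pt_continuous i t _ N2) as [e [e0 He]].
    exists (edist (pt (i, t)) p / 2), e; split; trivial; split; trivial.
    intros s Hs F; specialize (He s Hs); rewrite edist_sym in He.
    pose proof (edist_triangle (pt (i, t)) (pt (i, s)) p); lra.
- exists d; split; trivial; intros Q HQ.
  destruct (standard_exists Q) as [Q' [S SQ']].
  rewrite (proj1 (same_point_eq _ _ S)) in HQ.
  destruct (Hd Q' SQ' HQ) as [P [HP N]]; exists P; split; trivial.
  apply (near_same_point P Q'); trivial; now apply same_point_sym.
Qed.

Lemma curve_bounded : exists M, 0 <= M /\ forall P, nrm (pt P) <= M.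
Proof.
(* An upper bound for the norm is written as a lower bound for its reciprocal, to fit the
   monotonicity required of [Phi]. *)
destruct (standard_uniform (fun P d => nrm (pt P) * d <= 1)) as [d [d0 Hd]].
- intros P d d' dd H; pose proof (nrm_ge0 (pt P)).
  apply Rle_trans with (nrm (pt P) * d); trivial; apply Rmult_le_compat_l; lra.
- intros i t; destruct (pt_continuous i t 1 Rlt_0_1) as [e [e0 He]].
  pose proof (nrm_ge0 (pt (i, t))).
  exists (/ (nrm (pt (i, t)) + 1)), e.
  split; [apply Rinv_0_lt_compat; lra|]; split; trivial.
  intros s Hs; specialize (He s Hs).
  pose proof (nrm_edist (pt (i, s)) (pt (i, t))).
  apply Rle_div_l; [lra|]; lra.
- exists (/ d); split; [now apply Rlt_le, Rinv_0_lt_compat|].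
  intros P; destruct (standard_exists P) as [Q [S SQ]].
  rewrite (proj1 (same_point_eq _ _ S)).
  specialize (Hd Q SQ); apply Rmult_le_reg_r with d; trivial.
  rewrite Rinv_l; lra.
Qed.

Definition local_index (p q : R3) : Z := left_sum (strands p) q.

(** For [q] near [p], each strand through [q] continues one through [p]; the other strands through
    [p] miss [q]. *)
Lemma local_index_coherent : coherent local_index surf.
Proof.
intros p Sp.
destruct (strands_near p) as [d1 [d10 cov]].
destruct (list_uniform (fun P d => forall q, surf q -> edist q (pt P) < d ->
  (forall s, Rabs (s - snd P) < radius P -> pt (fst P, s) <> q) ->
  loc_const q (lft P)) (strands p)) as [d2 [d20 miss]].
{ intros P d d' dd H q Sq Hq; apply H; trivial; lra. }
{ intros P _; apply lft_miss. }
exists (Rmin d1 d2); split; [now apply Rmin_pos|].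
intros q Sq Hq; destruct (lt_Rmin _ _ _ Hq) as [Hq1 Hq2].
destruct (left_sum_loc_const q (strands p) (strands q)) as [k [d [d0 Hd]]];
  try apply strands_NoDup.
- intros P Q HP HQ; apply in_strands in HQ; destruct HQ as [<- _]; apply lft_hit.
- intros P HP M; apply (miss P HP q Sq).
  + apply in_strands in HP; now destruct HP as [-> _].
  + intros s Hs E; destruct (standard_exists (fst P, s)) as [Q [S SQ]].
    apply (M Q).
    * apply in_strands; split; trivial.
      now rewrite <- E; symmetry; apply same_point_eq.
    * apply (near_same_point P (fst P, s)); trivial; split; trivial.
      exists 0%Z; simpl; now rewrite Rplus_0_r.
- intros Q HQ; apply in_strands in HQ; destruct HQ as [HQ _].
  apply cov; now rewrite HQ.
- intros P P' Q HP HP' HQ N N'.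
  apply in_strands in HP; apply in_strands in HP'.
  apply standard_unique; try tauto.
  apply (near_disjoint P P' Q); trivial; destruct HP, HP'; congruence.
- intros P Q Q' HP HQ HQ' N N'.
  apply in_strands in HQ; apply in_strands in HQ'.
  apply standard_unique; try tauto.
  apply (near_injective P Q Q'); trivial; destruct HQ, HQ'; congruence.
- exists k, d; split; trivial; intros z Sz Hz; specialize (Hd z Sz Hz).
  unfold local_index; lia.
Qed.

Lemma index_exists : exists (U : R3 -> Prop) (g : R3 -> Z),
  trivializes local_index U g /\ (forall P, U (pt P)).
Proof.
pose proof local_index_coherent as co.
pose proof (fun P => pt_on_surface P) as onS.
destruct (dg_surface L).
- destruct curve_bounded as [M [M0 HM]].
  destruct (plane_trivial local_index M M0 co) as [g Hg].
  eexists; exists g; split; [exact Hg|].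
  intros P; specialize (HM P); specialize (onS P); simpl in onS.
  destruct (pt P) as [[x y] z].
  destruct (coord_le_nrm x y z) as [Hx [Hy _]].
  split; [|split]; trivial; apply Rabs_le_between; lra.
- destruct (sphere_trivial local_index co) as [g Hg].
  eexists; exists g; split; [exact Hg | trivial].
Qed.

(** ** Numbering the semiarcs *)

Lemma lft_own_curve (P Q : point) : same_point P Q -> exists d, 0 < d /\
  forall s, Rabs (s - snd P) < d -> lft Q (pt (fst P, s)) = 0%Z.
Proof.
destruct P as [i s0], Q as [j t]; intros [E [k Hk]]; simpl in *; subst j.
destruct (niceP (i, t)) as [_ [r0 _]].
exists (radius (i, t)); split; trivial; intros s Hs.
rewrite <- (pt_shift i s (- k)); apply lft0, (side_curve 1 (i, t)); [ring|]; simpl.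
rewrite opp_IZR; now replace (s + - IZR k - t) with (s - s0) by lra.
Qed.

(** The last condition of [nice] puts the direction [vel P] strictly inside a cone, so the curve
    itself stays inside for a while on either side of the crossing. *)
Lemma transverse_side sg (P Q : point) : meet (dg_curve L) Q P -> sg * sg = 1 ->
  0 < sg * dot (lnv Q) (vel P) ->
  exists d, 0 < d /\
    (forall s, snd P < s < snd P + d -> side sg Q (pt (fst P, s))) /\
    (forall s, snd P - d < s < snd P -> side (- sg) Q (pt (fst P, s))).
Proof.
intros M sg1 a0.
destruct (niceP Q) as [c0 [r0 [_ [_ [_ T]]]]].
specialize (T P M).
pose proof (nrm_ge0 (lnv Q)) as n0.
assert (A : Rabs (dot (lnv Q) (vel P)) = sg * dot (lnv Q) (vel P)).
{ assert (sg = 1 \/ sg = -1) as [-> | ->]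
    by (destruct (Rle_or_lt 0 sg); [left | right]; nra).
  - rewrite Rabs_pos_eq; lra.
  - rewrite Rabs_left; lra. }
rewrite A in T; set (a := sg * dot (lnv Q) (vel P)) in *.
set (m := ratio Q + nrm (lnv Q)).
assert (m0 : 0 < m) by (unfold m; lra).
(* A linearization error [e] costs [e * m] in the cone inequality, half of the slack at the tangent
   direction. *)
set (e := (a - ratio Q * nrm (vel P)) / (2 * m)).
assert (e0 : 0 < e) by (apply Rdiv_lt_0_compat; lra).
assert (em : e * m = (a - ratio Q * nrm (vel P)) / 2) by (unfold e; field; lra).
destruct (strict_derive3 _ _ (snd P) (dg_derive L (fst P)) (dg_C1 L (fst P) (snd P)) e e0)
  as [d [d0 Hd]].
assert (K : forall s, Rabs (s - snd P) < d -> s <> snd P ->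
  let w := vsub (pt (fst P, s)) (pt Q) in
  ratio Q * nrm w + Rabs (dot (lnv Q) w - (s - snd P) * dot (lnv Q) (vel P)) <
    Rabs (s - snd P) * a).
{ intros s Hs sP w.
  assert (Z0 : Rabs (snd P - snd P) < d) by now rewrite Rminus_diag, Rabs_R0.
  specialize (Hd s (snd P) Hs Z0).
  change (dg_curve L (fst P) s) with (pt (fst P, s)) in Hd.
  change (dg_curve L (fst P) (snd P)) with (pt P) in Hd.
  change (dg_velocity L (fst P) (snd P)) with (vel P) in Hd.
  replace (pt P) with (pt Q) in Hd by exact (proj1 M).
  fold w in Hd.
  pose proof (nrm_edist w (smul (s - snd P) (vel P))) as B; rewrite nrm_smul in B.
  pose proof (cauchy_schwarz (lnv Q) (vsub w (smul (s - snd P) (vel P)))) as CS.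
  fold (edist w (smul (s - snd P) (vel P))) in CS.
  rewrite dot_vsub_r, dot_smul in CS.
  set (r := Rabs (s - snd P)) in *.
  assert (rp : 0 < r) by (apply Rabs_pos_lt; lra).
  assert (nrm (lnv Q) * edist w (smul (s - snd P) (vel P)) <= nrm (lnv Q) * (e * r))
    by now apply Rmult_le_compat_l.
  assert (ratio Q * nrm w <= ratio Q * (r * nrm (vel P) + e * r))
    by (apply Rmult_le_compat_l; lra).
  assert (r * (e * m) = r * ((a - ratio Q * nrm (vel P)) / 2)) by now rewrite em.
  assert (0 < r * (a - ratio Q * nrm (vel P))) by (apply Rmult_lt_0_compat; lra).
  unfold m in *; lra. }
exists d; split; trivial.
(* The cone with apex at the crossing serves all parameters [s]. *)
split; intros s Hs; exists (snd Q); rewrite Rminus_diag, Rabs_R0; (split; [trivial|]);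
  rewrite <- surjective_pairing;
  (assert (H : Rabs (s - snd P) < d) by (apply Rabs_lt_between; lra));
  (assert (N : s <> snd P) by lra);
  specialize (K s H N); simpl in K; unfold edist;
  pose proof (Rle_abs (dot (lnv Q) (vsub (pt (fst P, s)) (pt Q)) -
    (s - snd P) * dot (lnv Q) (vel P)));
  pose proof (Rle_abs (- (dot (lnv Q) (vsub (pt (fst P, s)) (pt Q)) -
    (s - snd P) * dot (lnv Q) (vel P)))); rewrite Rabs_Ropp in *;
  unfold a in *;
  (assert (sg = 1 \/ sg = -1) as [-> | ->]
    by (destruct (Rle_or_lt 0 sg); [left | right]; nra)).
- rewrite (Rabs_right (s - snd P)) in K by lra; lra.
- rewrite (Rabs_right (s - snd P)) in K by lra; lra.
- rewrite (Rabs_left (s - snd P)) in K by lra; lra.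
- rewrite (Rabs_left (s - snd P)) in K by lra; lra.
Qed.

Lemma left_sum_0 (l : list point) z :
  (forall Q, In Q l -> lft Q z = 0%Z) -> left_sum l z = 0%Z.
Proof.
induction l as [|Q l IH]; intros H; simpl; trivial.
rewrite H, IH; simpl; auto; intros; apply H; now right.
Qed.

Lemma left_sum_single (l : list point) P z : NoDup l -> In P l ->
  (forall Q, In Q l -> Q <> P -> lft Q z = 0%Z) -> left_sum l z = lft P z.
Proof.
intros N I H; destruct (in_split P l I) as [l1 [l2 ->]].
rewrite left_sum_cat, left_sum_0; [lia|].
intros Q HQ; apply H.
- apply in_app_iff in HQ; apply in_app_iff; simpl; tauto.
- intros ->; now apply NoDup_remove_2 in N.
Qed.

(** * Values of the index along the curves *)

Section Index.

Context (U : R3 -> Prop) (g : R3 -> Z).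
Context (g_index : trivializes (local_index) U g).
Context (U_curve : forall P, U (pt P)).

Lemma index_near P : exists (k : Z) (d : R), 0 < d /\
  forall Q, fst Q = fst P -> Rabs (snd Q - snd P) < d ->
    g (pt Q) = (left_sum (strands (pt P)) (pt Q) + k)%Z.
Proof.
destruct (g_index _ (U_curve P)) as [k [e [e0 He]]].
destruct (pt_continuous (fst P) (snd P) e e0) as [d [d0 Hd]].
exists k, d; split; trivial; intros [j s] E Hs; simpl in E, Hs; subst j.
apply He; [apply U_curve|].
specialize (Hd s Hs); now rewrite <- surjective_pairing in Hd.
Qed.

(** All strands through an ordinary point are the curve itself, along which they count 0. *)
Lemma index_ordinary i t : ordinary L (i, t) ->
  exists d, 0 < d /\ forall s, Rabs (s - t) < d -> g (pt (i, s)) = g (pt (i, t)).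
Proof.
intros O; destruct (index_near (i, t)) as [k [d [d0 Hd]]]; simpl in Hd.
destruct (list_uniform (fun Q d => forall s, Rabs (s - t) < d -> lft Q (pt (i, s)) = 0%Z)
  (strands (pt (i, t)))) as [e [e0 He]].
- intros Q e e' ee H s Hs; apply H; lra.
- intros Q HQ; apply (lft_own_curve (i, t)).
  apply NNPP; intros S; apply O; exists Q; split; trivial.
  symmetry; now apply in_strands in HQ.
- assert (E : forall s, Rabs (s - t) < Rmin d e -> g (pt (i, s)) = k).
  { intros s Hs; destruct (lt_Rmin _ _ _ Hs).
    rewrite Hd, left_sum_0; trivial; intros Q HQ; now apply He. }
  exists (Rmin d e); split; [now apply Rmin_pos|].
  intros s Hs; rewrite !E; trivial.
  rewrite Rminus_diag, Rabs_R0; now apply Rmin_pos.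
Qed.

Lemma index_semiarc (A : semiarc L) P Q :
  proj1_sig A P -> proj1_sig A Q -> g (pt P) = g (pt Q).
Proof.
destruct A as [A [P0 [O HA]]]; simpl.
assert (E : forall P, A P -> g (pt P0) = g (pt P)).
{ clear P Q; intros [j t] AP; apply HA in AP; destruct AP as [E [k Hk]].
  destruct P0 as [i s]; simpl in E, Hk; subst j.
  rewrite <- (pt_shift i t k).
  set (u := t + IZR k) in *; clearbody u; clear t.
  assert (I : g (pt (i, Rmin s u)) = g (pt (i, Rmax s u))).
  { apply (locally_constant_interval (fun r => g (pt (i, r)))); [apply Rminmax|].
    intros x Hx; destruct (index_ordinary i x) as [d [d0 Hd]]; [now apply Hk|].
    exists d; auto. }
  revert I; unfold Rmin, Rmax; destruct (Rle_dec s u); auto. }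
intros AP AQ; now rewrite <- (E P), <- (E Q).
Qed.

(** Along each strand only the other one counts. The negative frame means that the strand of [P]
    passes from the right to the left of that of [Q], and the strand of [Q] from the left to the
    right of that of [P]. *)
Lemma index_crossing P Q : crossing L P Q -> exists (k : Z) (d : R), 0 < d /\
  (forall s, snd P - d < s < snd P -> g (pt (fst P, s)) = k) /\
  (forall s, snd P < s < snd P + d -> g (pt (fst P, s)) = (k + 1)%Z) /\
  (forall s, snd Q - d < s < snd Q -> g (pt (fst Q, s)) = (k + 1)%Z) /\
  (forall s, snd Q < s < snd Q + d -> g (pt (fst Q, s)) = k).
Proof.
intros [[E NS] D]; change (pt P = pt Q) in E.
rewrite det3_dot in D; change (dot (lnv P) (vel Q) < 0) in D.
assert (D' : 0 < dot (lnv Q) (vel P)).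
{ unfold lnv, nu in *; rewrite E in D; rewrite <- det3_dot in *.
  destruct (normal (dg_surface L) (pt Q)) as [[? ?] ?], (vel P) as [[? ?] ?],
    (vel Q) as [[? ?] ?]; simpl in *; lra. }
destruct (index_near P) as [k [d1 [d10 H1]]], (index_near Q) as [k' [d2 [d20 H2]]].
assert (Z0 : forall x, Rabs (x - x) = 0) by (intros; now rewrite Rminus_diag, Rabs_R0).
(* Both constants are read off at the crossing itself, where the list of strands is the same. *)
assert (k' = k) as ->.
{ specialize (H1 P eq_refl); specialize (H2 Q eq_refl); rewrite Z0 in H1, H2.
  rewrite <- E in H2; specialize (H1 d10); specialize (H2 d20); lia. }
rewrite <- E in H2.
destruct (standard_exists P) as [P' [SP SP']], (standard_exists Q) as [Q' [SQ SQ']].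
pose proof (proj1 (same_point_eq _ _ SP)) as EP.
pose proof (proj1 (same_point_eq _ _ SQ)) as EQ.
assert (IP : In P' (strands (pt P))) by now apply in_strands.
assert (IQ : In Q' (strands (pt P))) by (apply in_strands; split; [congruence | trivial]).
assert (only : forall T, In T (strands (pt P)) -> T = P' \/ T = Q').
{ intros T HT; apply in_strands in HT; destruct HT as [HT ST].
  destruct (classic (same_point P T)) as [S | S].
  - left; apply (standard_unique); trivial.
    apply (same_point_trans _ P); trivial; now apply same_point_sym.
  - right; apply (standard_unique); trivial.
    apply (same_point_trans _ Q); [|trivial].
    apply (dg_no_triple L P); split; trivial; exact (eq_sym HT). }
assert (MP : meet (dg_curve L) P' Q).
{ split; [exact (eq_trans (eq_sym EP) E)|].
  intros S; apply NS; now apply (same_point_trans _ P'). }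
assert (MQ : meet (dg_curve L) Q' P).
{ split; [exact (eq_trans (eq_sym EQ) (eq_sym E))|].
  intros S; apply NS; apply same_point_sym; now apply (same_point_trans _ Q'). }
rewrite (lnv_eq P P' SP) in D; rewrite (lnv_eq Q Q' SQ) in D'.
destruct (transverse_side (-1) Q P' MP) as [d3 [d30 [H3 H3']]]; [ring | lra|].
destruct (transverse_side 1 P Q' MQ) as [d4 [d40 [H4 H4']]]; [ring | lra|].
destruct (lft_own_curve P P' SP) as [d5 [d50 H5]].
destruct (lft_own_curve Q Q' SQ) as [d6 [d60 H6]].
replace (- (-1)) with 1 in H3' by ring.
assert (GP : forall s, Rabs (s - snd P) < d1 -> Rabs (s - snd P) < d5 ->
  g (pt (fst P, s)) = (k + lft Q' (pt (fst P, s)))%Z).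
{ intros s Hs1 Hs5; rewrite H1 by trivial.
  rewrite (left_sum_single _ Q'); [lia | apply strands_NoDup | trivial |].
  intros T HT TQ; destruct (only T HT) as [-> | ->]; [auto | easy]. }
assert (GQ : forall s, Rabs (s - snd Q) < d2 -> Rabs (s - snd Q) < d6 ->
  g (pt (fst Q, s)) = (k + lft P' (pt (fst Q, s)))%Z).
{ intros s Hs1 Hs5; rewrite H2 by trivial.
  rewrite (left_sum_single _ P'); [lia | apply strands_NoDup | trivial |].
  intros T HT TQ; destruct (only T HT) as [-> | ->]; [easy | auto]. }
set (d := Rmin (Rmin d1 d2) (Rmin (Rmin d3 d4) (Rmin d5 d6))).
assert (d0 : 0 < d) by (repeat apply Rmin_pos; trivial).
assert (B : d <= d1 /\ d <= d2 /\ d <= d3 /\ d <= d4 /\ d <= d5 /\ d <= d6).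
{ pose proof (Rmin_l (Rmin d1 d2) (Rmin (Rmin d3 d4) (Rmin d5 d6))).
  pose proof (Rmin_r (Rmin d1 d2) (Rmin (Rmin d3 d4) (Rmin d5 d6))).
  pose proof (Rmin_l d1 d2); pose proof (Rmin_r d1 d2).
  pose proof (Rmin_l (Rmin d3 d4) (Rmin d5 d6)); pose proof (Rmin_r (Rmin d3 d4) (Rmin d5 d6)).
  pose proof (Rmin_l d3 d4); pose proof (Rmin_r d3 d4).
  pose proof (Rmin_l d5 d6); pose proof (Rmin_r d5 d6).
  fold d in H, H0; lra. }
exists k, d; split; trivial; split; [|split; [|split]]; intros s Hs.
- rewrite GP by (apply Rabs_lt_between; lra).
  rewrite lft_right; [lia | apply H4'; lra].
- rewrite GP by (apply Rabs_lt_between; lra).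
  rewrite lft1; [lia | apply H4; lra].
- rewrite GQ by (apply Rabs_lt_between; lra).
  rewrite lft1; [lia | apply H3'; lra].
- rewrite GQ by (apply Rabs_lt_between; lra).
  rewrite lft_right; [lia | apply H3; lra].
Qed.

End Index.

Lemma incoming_near P A d : 0 < d -> incoming L P A ->
  exists s, snd P - d < s < snd P /\ proj1_sig A (fst P, s).
Proof.
intros d0 [e [e0 H]]; pose proof (Rmin_l d e); pose proof (Rmin_r d e).
pose proof (Rmin_pos d e d0 e0).
exists (snd P - Rmin d e / 2); split; [lra | apply H; lra].
Qed.

Lemma outgoing_near P A d : 0 < d -> outgoing L P A ->
  exists s, snd P < s < snd P + d /\ proj1_sig A (fst P, s).
Proof.
intros d0 [e [e0 H]]; pose proof (Rmin_l d e); pose proof (Rmin_r d e).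
pose proof (Rmin_pos d e d0 e0).
exists (snd P + Rmin d e / 2); split; [lra | apply H; lra].
Qed.

Lemma numbering_exists : exists a : semiarc L -> Z,
  forall P Q TL TR BL BR, crossing L P Q ->
    incoming L P TL -> incoming L Q TR -> outgoing L Q BL -> outgoing L P BR ->
    a TR = (a TL + 1)%Z /\ a BL = a TL /\ a BR = (a TL + 1)%Z.
Proof.
destruct (index_exists) as [U [g [Hg HU]]].
assert (ne : forall A : semiarc L, exists P, proj1_sig A P).
{ intros [A [P [O HA]]]; exists P; apply HA; split; trivial.
  exists 0%Z; rewrite Rplus_0_r; intros r Hr.
  replace r with (snd P); [now rewrite <- surjective_pairing|].
  revert Hr; unfold Rmin, Rmax; destruct (Rle_dec (snd P) (snd P)); lra. }
exists (fun A => g (pt (proj1_sig (constructive_indefinite_description _ (ne A))))).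
assert (aE : forall A P, proj1_sig A P ->
  g (pt (proj1_sig (constructive_indefinite_description _ (ne A)))) = g (pt P)).
{ intros A P AP; apply (index_semiarc U g Hg HU A); trivial.
  apply (proj2_sig (constructive_indefinite_description _ (ne A))). }
intros P Q TL TR BL BR C iTL iTR oBL oBR.
destruct (index_crossing U g Hg HU P Q C) as [k [d [d0 [HTL [HBR [HTR HBL]]]]]].
destruct (incoming_near P TL d d0 iTL) as [s1 [S1 A1]].
destruct (incoming_near Q TR d d0 iTR) as [s2 [S2 A2]].
destruct (outgoing_near Q BL d d0 oBL) as [s3 [S3 A3]].
destruct (outgoing_near P BR d d0 oBR) as [s4 [S4 A4]].
rewrite (aE _ _ A1), (aE _ _ A2), (aE _ _ A3), (aE _ _ A4).
rewrite (HTL _ S1), (HTR _ S2), (HBL _ S3), (HBR _ S4); auto.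
Qed.

End Diagram.

(** * Twisting the colors *)

Section Twist.

Context {X : Type} (V : virtual_biquandle X).

Local Notation f := (vb_f V).
Local Notation f' := (vb_finv V).
Local Notation R := (bq_op (vb_bq V)).
Local Notation R' := (bq_inv (vb_bq V)).

(** [Z.to_nat] truncates at 0, so at most one of the two iterations is not empty. *)
Definition zpow (k : Z) (x : X) : X :=
  Nat.iter (Z.to_nat k) f (Nat.iter (Z.to_nat (- k)) f' x).

Lemma zpow_succ k x : zpow (k + 1) x = f (zpow k x).
Proof.
unfold zpow; destruct (Z_le_gt_dec 0 k).
- replace (Z.to_nat (k + 1)) with (S (Z.to_nat k)) by lia.
  now replace (Z.to_nat (- (k + 1))) with (Z.to_nat (- k)) by lia.
- replace (Z.to_nat (- k)) with (S (Z.to_nat (- (k + 1)))) by lia.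
  replace (Z.to_nat (k + 1)) with 0%nat by lia; replace (Z.to_nat k) with 0%nat by lia.
  simpl; now rewrite (vb_finvK X V).
Qed.

(** The downward step removes an [f] rather than adding an inverse; for identities such as commuting
    with [R] it follows from injectivity of [f]. *)
Lemma zpow_ind (T : (X -> X) -> Prop) :
  T (fun x => x) -> (forall h, T h -> T (fun x => f (h x))) ->
  (forall h, T (fun x => f (h x)) -> T h) -> forall k, T (zpow k).
Proof.
intros T0 Tf Tf' k.
assert (Ts : forall k, T (zpow k) <-> T (zpow (k + 1))).
{ intros m; replace (zpow (m + 1)) with (fun x => f (zpow m x)); [split; auto|].
  apply functional_extensionality; intros x; now rewrite zpow_succ. }
apply (Z.bi_induction (fun k => T (zpow k))).
- intros ? ? ->; tauto.
- exact T0.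
- intros m; rewrite Ts; now replace (m + 1)%Z with (Z.succ m) by lia.
Qed.

Lemma vb_f_injective x y : f x = f y -> x = y.
Proof. intros E; now rewrite <- (vb_fK X V x), E, (vb_fK X V). Qed.

Lemma zpow_op k p : map_pair (zpow k) (R p) = R (map_pair (zpow k) p).
Proof.
revert p; apply (zpow_ind (fun h => forall p, map_pair h (R p) = R (map_pair h p))).
- intros [x y]; now unfold map_pair; simpl; rewrite <- surjective_pairing.
- intros h H p; change (map_pair f (map_pair h (R p)) = R (map_pair f (map_pair h p))).
  now rewrite H, (vb_f_op X V).
- intros h H p; specialize (H p).
  change (map_pair f (map_pair h (R p)) = R (map_pair f (map_pair h p))) in H.
  rewrite <- (vb_f_op X V) in H; unfold map_pair in H at 1 3; injection H; intros.
  rewrite (surjective_pairing (R (map_pair h p))).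
  unfold map_pair at 1; f_equal; now apply vb_f_injective.
Qed.

Lemma zpow_inv k p : map_pair (zpow k) (R' p) = R' (map_pair (zpow k) p).
Proof.
rewrite <- (bq_opK X (vb_bq V) (map_pair (zpow k) (R' p))), <- zpow_op.
now rewrite (bq_invK X).
Qed.

Lemma zpow_bij k x : zpow k (zpow (- k) x) = x.
Proof.
revert x; pattern k; apply Z.bi_induction.
- intros ? ? ->; tauto.
- reflexivity.
- assert (C : forall m x, zpow m (f x) = f (zpow m x)).
  { intros m; apply (zpow_ind (fun h => forall x, h (f x) = f (h x))); trivial.
    - intros h H x; now rewrite H.
    - intros h H x; now apply vb_f_injective. }
  intros m; unfold Z.succ.
  assert (E : forall x, zpow (m + 1) (zpow (- (m + 1)) x) = zpow m (zpow (- m) x)).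
  { intros x; rewrite zpow_succ, <- C, <- zpow_succ; f_equal; f_equal; lia. }
  split; intros H x; specialize (H x); [now rewrite E | now rewrite E in H].
Qed.

Lemma zpow_injective k x y : zpow k x = zpow k y -> x = y.
Proof.
intros E; rewrite <- (zpow_bij (- k) x), <- (zpow_bij (- k) y).
now rewrite Z.opp_involutive, E.
Qed.

(** [zpow k] commutes with [R], its inverse and [f], and can be cancelled, so only [k = 0] matters.
    There the claim is that [R] sends [(x, f y)] to [(z, f w)] exactly when [VR] sends [(x, y)] to
    [(z, w)], and likewise for the inverses. At a virtual crossing the inverse of [f] undoes the
    extra power on [y], and [f] supplies the one on [w]. *)
Lemma rule_twist kd k x y z w :
  (zpow k z, zpow (k + 1) w) =
    virtual_biquandle_rule V kd (zpow k x, zpow (k + 1) y) <->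
  (z, w) = biquandle_rule (VR_biquandle V) kd (x, y).
Proof.
assert (inj : forall a b c d : X, (zpow k a, zpow k b) = (zpow k c, zpow k d) ->
  a = c /\ b = d).
{ intros a b c d E; injection E; intros; split; now apply (zpow_injective k). }
assert (comm : forall u, zpow (k + 1) u = zpow k (f u)).
{ intros u; rewrite zpow_succ; revert u.
  apply (zpow_ind (fun h => forall u, f (h u) = h (f u))); trivial.
  - intros h H u; now rewrite H.
  - intros h H u; now apply vb_f_injective. }
destruct kd; cbn [virtual_biquandle_rule biquandle_rule].
- change (bq_op (VR_biquandle V) (x, y)) with (VR V (x, y)).
  rewrite !comm, VR_conj.
  change (zpow k x, zpow k (f y)) with (map_pair (zpow k) (x, f y)).
  rewrite <- zpow_op; split.
  + intros E; apply inj in E; destruct E as [-> E].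
    f_equal; now rewrite <- E, (vb_fK X V).
  + intros E; injection E; intros -> ->; now rewrite (vb_finvK X V).
- change (bq_inv (VR_biquandle V) (x, y)) with (VR_inv V (x, y)).
  unfold VR_inv; cbn [fst snd]; rewrite !comm.
  change (zpow k x, zpow k (f y)) with (map_pair (zpow k) (x, f y)).
  rewrite <- zpow_inv; split.
  + intros E; apply inj in E; destruct E as [-> E].
    f_equal; now rewrite <- E, (vb_fK X V).
  + intros E; injection E; intros -> ->; now rewrite (vb_finvK X V).
- cbn [fst snd]; rewrite (zpow_succ k y), (vb_fK X V), zpow_succ; split.
  + intros E; injection E; intros E1 E2.
    apply vb_f_injective in E1; apply zpow_injective in E1, E2; congruence.
  + intros E; injection E; now intros -> ->.
Qed.

Lemma obeys_twist L (a : semiarc L -> Z)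
    (Ha : forall P Q TL TR BL BR, crossing L P Q ->
       incoming L P TL -> incoming L Q TR -> outgoing L Q BL -> outgoing L P BR ->
       a TR = (a TL + 1)%Z /\ a BL = a TL /\ a BR = (a TL + 1)%Z)
    (c : semiarc L -> X) :
  obeys L (virtual_biquandle_rule V) (fun A => zpow (a A) (c A)) <->
  obeys L (biquandle_rule (VR_biquandle V)) c.
Proof.
split; intros H P Q TL TR BL BR C iTL iTR oBL oBR;
  specialize (H P Q TL TR BL BR C iTL iTR oBL oBR);
  destruct (Ha P Q TL TR BL BR C iTL iTR oBL oBR) as [ETR [EBL EBR]];
  cbv beta in *; pose proof (rule_twist (kind L P) (a TL) (c TL) (c TR) (c BL) (c BR)) as T;
  rewrite <- EBR, <- EBL in T at 1; rewrite <- ETR in T; tauto.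
Qed.

End Twist.

Theorem theorem3p2 (X : Type) (V : virtual_biquandle X) (L : diagram) :
  exists h : virtual_biquandle_coloring V L ->
             biquandle_coloring (VR_biquandle V) L,
    Bijective h.
Proof.
destruct (numbering_exists L) as [a Ha].
assert (E : forall c : semiarc L -> X, (fun A => zpow V (a A) (zpow V (- a A) (c A))) = c).
{ intros c; apply functional_extensionality; intros A; apply zpow_bij. }
assert (E' : forall c : semiarc L -> X, (fun A => zpow V (- a A) (zpow V (a A) (c A))) = c).
{ intros c; apply functional_extensionality; intros A.
  rewrite <- (Z.opp_involutive (a A)) at 2; apply zpow_bij. }
assert (H1 : forall c, obeys L (virtual_biquandle_rule V) c ->
  obeys L (biquandle_rule (VR_biquandle V)) (fun A => zpow V (- a A) (c A))).
{ intros c Hc; apply (obeys_twist V L a Ha); now rewrite E. }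
assert (H2 : forall c, obeys L (biquandle_rule (VR_biquandle V)) c ->
  obeys L (virtual_biquandle_rule V) (fun A => zpow V (a A) (c A))).
{ intros c Hc; now apply (obeys_twist V L a Ha). }
exists (fun c => exist _ _ (H1 _ (proj2_sig c))), (fun c => exist _ _ (H2 _ (proj2_sig c))).
split; intros [c Hc]; apply eq_sig_hprop; simpl; auto; intros; apply proof_irrelevance.
Qed.
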